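(* Let $H$ be a complex Hilbert space, $\lambda\in[0,1]$ and $T\in\mathcal{B}(H)$. The following assertions are equivalent: (i) $T$ is normaloid; (ii) $\|T\|^k=\|\Delta_\lambda(T^k)\|$ for all natural numbers $k$; (iii) $\|T\|^k=\|\Delta_\lambda^n(T^k)\|$ for all natural numbers $k$ and $n$.
   Context: $H$ is a (nonzero) complex Hilbert space, $\mathcal{B}(H)$ is the space of bounded linear operators on $H$ with the operator norm $\|\cdot\|$, and $r(T)$ is the spectral radius of $T$. An operator $T$ is normaloid if $r(T)=\|T\|$. For $T\in\mathcal{B}(H)$, $|T|=(T^*T)^{1/2}$ and $T=U|T|$ is the unique polar decomposition, with $U$ the partial isometry satisfying $\ker U=\ker T$. For $\lambda\in[0,1]$ the $\lambda$-Aluthge transform is $\Delta_\lambda(T)=|T|^{\lambda}U|T|^{1-\lambda}$, with the convention $|T|^0=I$, so that $\Delta_0(T)=U|T|=T$ and $\Delta_1(T)=|T|U$. Its iterates are $\Delta_\lambda^0(T)=T$ and $\Delta_\lambda^{n+1}(T)=\Delta_\lambda(\Delta_\lambda^n(T))$. Natural numbers include $0$, with $T^0=I$ and $\|T\|^0=1$. *)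

(* Defs.v *)
From HB Require Import structures.
From mathcomp Require Import all_boot all_order all_algebra.
From mathcomp Require Import complex.
From mathcomp Require Import all_classical all_reals all_analysis.

Set Implicit Arguments.
Unset Strict Implicit.
Unset Printing Implicit Defensive.

Import Order.TTheory GRing.Theory Num.Theory.
Import numFieldNormedType.Exports.

Local Open Scope classical_set_scope.
Local Open Scope ring_scope.
Local Open Scope complex_scope.

(* Complex Hilbert spaces; [inner] is linear in its first argument. *)
HB.mixin Record CompleteNormedModule_isHilbert (R : realType) H
    & CompleteNormedModule R[i] H := {
  inner : {dot H for @Num.conj R[i]} ;
  inner_normE : forall x : H, inner x x = `|x| ^+ 2
}.

#[short(type="hilbertType")]
HB.structure Definition Hilbert (R : realType) :=
  {H of CompleteNormedModule_isHilbert R H & CompleteNormedModule R[i] H}.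

Section Operators.
Context {R : realType} {H : hilbertType R}.
Implicit Types T U A B S : H -> H.

Definition bounded_operator T : Prop := linear T /\ continuous T.

(* Norms of vectors live in R[i]; their real parts are the usual real norms. *)
Definition opnorm T : R := sup [set complex.Re `|T x| | x in [set x | `|x| <= 1]].

Definition spectrum T : set R[i] :=
  [set z | ~ exists S, [/\ bounded_operator S,
                           forall x, S (z *: x - T x) = x &
                           forall x, z *: S x - T (S x) = x]].

Definition spectral_radius T : R := sup [set complex.Re `|z| | z in spectrum T].

Definition normaloid T : Prop := spectral_radius T = opnorm T.

Definition adjoint T : H -> H :=
  get [set S | bounded_operator S /\ forall x y, inner (T x) y = inner x (S y)].

Definition poly_op (p : {poly R}) A : H -> H :=
  fun x => \sum_(i < size p) (p`_i)%:C *: iter i A x.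

(* Continuous functional calculus: for A self-adjoint and f continuous on the
   (real) spectrum of A, [cfc f A] is the norm limit of p(A) as the real
   polynomials p converge to f uniformly on the spectrum of A.  It is unique
   by the Weierstrass approximation theorem. *)
Definition cfc (f : R -> R) A : H -> H :=
  get [set B | bounded_operator B /\
    forall e : R, 0 < e -> exists2 d : R, 0 < d &
      forall p : {poly R},
        (forall t : R, spectrum A t%:C -> `|p.[t] - f t| <= d) ->
        opnorm (poly_op p A \- B) <= e].

(* A ^ s for A positive.  As [0 `^ 0 = 1], [op_power A 0] is the identity. *)
Definition op_power A (s : R) : H -> H := cfc (fun t => t `^ s) A.

Definition op_abs T : H -> H := op_power (adjoint T \o T) 2^-1.

Definition partial_isometry U : Prop :=
  bounded_operator U /\
  forall x, (forall y, U y = 0 -> inner x y = 0) -> `|U x| = `|x|.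

Definition polar_part T : H -> H :=
  get [set U | [/\ partial_isometry U, T = U \o op_abs T &
                   forall x, U x = 0 <-> T x = 0]].

Definition aluthge (lambda : R) T : H -> H :=
  op_power (op_abs T) lambda \o polar_part T \o op_power (op_abs T) (1 - lambda).

End Operators.

(* Main.v *)
(* An operator T is normaloid iff ||T^k|| = ||T||^k for all k.  One direction is
   the spectral mapping z |-> z^k together with |z| <= ||T|| on the spectrum.  For
   the other, if ||T^n x|| is about ||T||^n ||x||, averaging over unimodular w
   shows that y = \sum_(j < n) w^j ||T||^-j T^j x has norm at least of order
   sqrt(n) ||x|| for some w with w^n = 1, while w T y - ||T|| y telescopes to
   something of norm at most 2 ||T|| ||x||; a limit point of the numbers ||T|| / w
   as n grows is in the spectrum and has modulus ||T||.

   Writing T = B C with B = U |T|^(1 - lambda) and C = |T|^lambda, the transform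
   is C B, and ||B|| ||C|| <= ||T||.  As (B C)^(k+1) = B (C B)^k C, if
   ||T^k|| = ||T||^k for all k, then C B has the same property and the same norm
   as T, so both pass to all iterates.  Conversely ||C B|| <= ||B|| ||C|| for the
   factors of T^k turns (ii) into ||T||^k <= ||T^k||.

   The continuous functional calculus rests on ||p(A)|| = sup |p| over the
   spectrum of a self-adjoint A, obtained by factoring the polynomial
   ||p(A)||^2 - p^2, and on Bernstein approximation of t^s; invertibility of
   operators comes from coercivity and orthogonal projection. *)

From HB Require Import structures.
Require Import Defs.
From mathcomp Require Import all_boot all_order all_algebra.
From mathcomp Require Import complex ring lra.
From mathcomp Require Import all_classical all_reals all_analysis.

Set Implicit Arguments.
Unset Strict Implicit.
Unset Printing Implicit Defensive.

Import Order.TTheory GRing.Theory Num.Theory.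
Import numFieldNormedType.Exports.

Local Open Scope ring_scope.
Local Open Scope complex_scope.

(** * Norm and inner product *)

Section ComplexModulus.
Context {R : realType}.
Implicit Types z w : R[i].

(** Norms over [R[i]] take values in [R[i]], whose order is only partial; [cabs], like [nrm] for
    vectors, moves estimates to [R], where [lra] and [nra] apply. *)
Definition cabs z : R := complex.Re `|z|.

Lemma cabsE z : `|z| = (cabs z)%:C.
Proof. by rewrite /cabs normc_def. Qed.

Lemma cabs_ge0 z : 0 <= cabs z.
Proof. by rewrite -ler0c -cabsE. Qed.

Lemma cabs_eq0 z : (cabs z == 0) = (z == 0).
Proof. by rewrite -(normr_eq0 z) cabsE -(inj_eq (@complexI R)). Qed.

Lemma cabsM z w : cabs (z * w) = cabs z * cabs w.
Proof. by apply: complexI; rewrite rmorphM /= -!cabsE normrM. Qed.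

Lemma cabsX z n : cabs (z ^+ n) = cabs z ^+ n.
Proof. by apply: complexI; rewrite rmorphXn /= -!cabsE normrX. Qed.

Lemma cabs_real (a : R) : cabs a%:C = `|a|.
Proof. by rewrite /cabs normc_def /= expr0n addr0 sqrtr_sqr. Qed.

Lemma cabsD z w : cabs (z + w) <= cabs z + cabs w.
Proof. by rewrite -lecR rmorphD /= -!cabsE ler_normD. Qed.

Lemma cabsN z : cabs (- z) = cabs z.
Proof. by rewrite /cabs normrN. Qed.

Lemma cabs1 : cabs 1 = 1.
Proof. by rewrite /cabs normr1. Qed.

Lemma Re_le_cabs z : `|complex.Re z| <= cabs z.
Proof. by rewrite -lecR -cabsE normc_ge_Re. Qed.

Lemma cabs_conj z : cabs (conjc z) = cabs z.
Proof. by rewrite /cabs normcJ. Qed.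

Lemma cabs_sqrE z : cabs z ^+ 2 = complex.Re z ^+ 2 + complex.Im z ^+ 2.
Proof. by apply: complexI; rewrite rmorphXn /= -cabsE -add_Re2_Im2. Qed.

Lemma cReM z w : complex.Re (z * w) =
  complex.Re z * complex.Re w - complex.Im z * complex.Im w.
Proof. by case: z; case: w. Qed.

Lemma cImM z w : complex.Im (z * w) =
  complex.Re z * complex.Im w + complex.Im z * complex.Re w.
Proof. by case: z => a b; case: w => c d. Qed.

Lemma cReD z w : complex.Re (z + w) = complex.Re z + complex.Re w.
Proof. by case: z; case: w. Qed.

Lemma cImD z w : complex.Im (z + w) = complex.Im z + complex.Im w.
Proof. by case: z; case: w. Qed.

Lemma cImN z : complex.Im (- z) = - complex.Im z.
Proof. by case: z. Qed.

Lemma cReN z : complex.Re (- z) = - complex.Re z.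
Proof. by case: z. Qed.

Lemma cReJ z : complex.Re (conjc z) = complex.Re z.
Proof. by case: z. Qed.

Lemma conjcM z w : conjc (z * w) = conjc z * conjc w.
Proof. exact: rmorphM. Qed.

Lemma conjEc z : Num.conj z = conjc z.
Proof.
have [->|z0] := eqVneq z 0; first by rewrite rmorph0 conjc0.
by apply: (mulfI z0); rewrite -normCK sqr_normc.
Qed.

End ComplexModulus.

Section HilbertBasics.
Context {R : realType} {H : hilbertType R}.
Implicit Types x y v : H.

Definition nrm x : R := complex.Re `|x|.
Definition rip x y : R := complex.Re (inner x y).

Lemma nrmE x : `|x| = (nrm x)%:C.
Proof. by rewrite /nrm RRe_real ?normr_real. Qed.

Lemma nrm_ge0 x : 0 <= nrm x.
Proof. by rewrite -ler0c -nrmE. Qed.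

Lemma nrm_eq0 x : (nrm x == 0) = (x == 0).
Proof. by rewrite -(normr_eq0 x) nrmE -(inj_eq (@complexI R)). Qed.

Lemma nrm0 : nrm 0 = 0. Proof. by apply/eqP; rewrite nrm_eq0. Qed.

Lemma nrm0_eq0 x : nrm x = 0 -> x = 0.
Proof. by move=> /eqP; rewrite nrm_eq0 => /eqP. Qed.

Lemma nrm_gt0 x : (0 < nrm x) = (x != 0).
Proof. by rewrite lt_def nrm_eq0 nrm_ge0 andbT. Qed.

Lemma nrmD x y : nrm (x + y) <= nrm x + nrm y.
Proof. by rewrite -lecR rmorphD /= -!nrmE ler_normD. Qed.

Lemma nrmN x : nrm (- x) = nrm x.
Proof. by rewrite /nrm normrN. Qed.

Lemma nrmB x y : nrm (x - y) <= nrm x + nrm y.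
Proof. by rewrite -(nrmN y) nrmD. Qed.

Lemma nrm_distC x y : nrm (x - y) = nrm (y - x).
Proof. by rewrite -nrmN opprB. Qed.

Lemma nrm_distD v x y : nrm (x - y) <= nrm (x - v) + nrm (v - y).
Proof. by rewrite -{1}(subrK v x) -addrA nrmD. Qed.

Lemma nrmZ (a : R[i]) x : nrm (a *: x) = cabs a * nrm x.
Proof. by apply: complexI; rewrite rmorphM /= -cabsE -!nrmE normrZ. Qed.

Lemma nrmZr (a : R) x : nrm (a%:C *: x) = `|a| * nrm x.
Proof. by rewrite nrmZ cabs_real. Qed.

Lemma inner_xx x : inner x x = (nrm x ^+ 2)%:C.
Proof. by rewrite inner_normE nrmE rmorphXn. Qed.

Lemma innerDl x y v : inner (x + y) v = inner x v + inner y v.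
Proof. exact: linearDl. Qed.

Lemma innerDr x y v : inner v (x + y) = inner v x + inner v y.
Proof. exact: linearDr. Qed.

Lemma innerNr x v : inner v (- x) = - inner v x.
Proof. exact: linearNr. Qed.

Lemma innerBl x y v : inner (x - y) v = inner x v - inner y v.
Proof. exact: linearBl. Qed.

Lemma innerBr x y v : inner v (x - y) = inner v x - inner v y.
Proof. exact: linearBr. Qed.

Lemma inner0l v : inner 0 v = 0 :> R[i].
Proof. exact: linear0l. Qed.

Lemma inner0r v : inner v 0 = 0 :> R[i].
Proof. exact: linear0r. Qed.

Lemma innerZl (a : R[i]) x v : inner (a *: x) v = a * inner x v.
Proof. exact: linearZl_LR. Qed.

Lemma innerZr (a : R[i]) x v : inner v (a *: x) = conjc a * inner v x.
Proof. by rewrite linearZr /= ?conjEc. Qed.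

Lemma innerC x y : inner y x = conjc (inner x y).
Proof. by rewrite hermC expr0 mul1r /= conjEc. Qed.

Lemma inner_injr x y : (forall z : H, inner z x = inner z y) -> x = y.
Proof.
move=> xy; apply/eqP; rewrite -subr_eq0 -nrm_eq0 -sqrf_eq0; apply/eqP.
by apply: complexI; rewrite -inner_xx innerBr xy subrr.
Qed.

Lemma ripC x y : rip x y = rip y x.
Proof. by rewrite /rip (innerC x y) cReJ. Qed.

Lemma nrm_sqrD x y : nrm (x + y) ^+ 2 = nrm x ^+ 2 + 2 * rip x y + nrm y ^+ 2.
Proof.
have E v : nrm v ^+ 2 = rip v v by rewrite /rip inner_xx.
rewrite !E /rip innerDl !innerDr !cReD -/(rip x y) -/(rip y x) (ripC y x).
by rewrite mulr_natl mulr2n; ring.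
Qed.

Lemma ripNr x y : rip x (- y) = - rip x y.
Proof. by rewrite /rip innerNr cReN. Qed.

Lemma nrm_sqrB x y : nrm (x - y) ^+ 2 = nrm x ^+ 2 - 2 * rip x y + nrm y ^+ 2.
Proof. by rewrite nrm_sqrD ripNr nrmN; ring. Qed.

Lemma parallelogram x y :
  nrm (x + y) ^+ 2 + nrm (x - y) ^+ 2 = 2 * (nrm x ^+ 2 + nrm y ^+ 2).
Proof. by rewrite nrm_sqrD nrm_sqrB; ring. Qed.

(* Applied to [x] and [<x,y> y], the real inequality, which is the triangle
   inequality squared, gives the complex one. *)
Lemma cauchy_schwarz x y : cabs (inner x y) <= nrm x * nrm y.
Proof.
have real_cs v : rip x v <= nrm x * nrm v.
  have := nrmD x v; rewrite -ler_sqr ?nnegrE ?addr_ge0 ?nrm_ge0 //.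
  by rewrite nrm_sqrD; nra.
have [->|w0] := eqVneq (cabs (inner x y)) 0; first by rewrite mulr_ge0 ?nrm_ge0.
have wgt0 : 0 < cabs (inner x y) by rewrite lt_def w0 cabs_ge0.
have := real_cs (inner x y *: y).
have -> : rip x (inner x y *: y) = cabs (inner x y) ^+ 2.
  by rewrite /rip innerZr mulrC -sqr_normc cabsE -rmorphXn.
by rewrite nrmZ mulrCA expr2 ler_pM2l.
Qed.

Lemma rip_le x y : `|rip x y| <= nrm x * nrm y.
Proof. exact: le_trans (Re_le_cabs _) (cauchy_schwarz _ _). Qed.

Lemma nrm_complete (u : nat -> H) :
  (forall e : R, 0 < e -> exists N, forall m n, (N <= m)%N -> (N <= n)%N ->
     nrm (u m - u n) <= e) ->
  exists l, forall e : R, 0 < e -> exists N, forall n, (N <= n)%N ->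
     nrm (u n - l) <= e.
Proof.
move=> cau.
have : cauchy (u @ \oo)%classic.
  apply/cauchy_ballP => e; rewrite ltcE => /andP[/eqP eI eR].
  have [|N uN] := cau (complex.Re e / 2); first by rewrite divr_gt0.
  pose tail := (u @` [set n | (N <= n)%N])%classic.
  have tailN : (u @ \oo)%classic tail by exists N => // n /= Nn; exists n.
  exists (tail, tail); first by split.
  move=> [_ _] /= [[m /= Nm <-] [n /= Nn <-]].
  rewrite -ball_normE /= nrmE ltcE /= eI eqxx /=.
  by rewrite (le_lt_trans (uN _ _ Nm Nn)) // ltr_pdivrMr // ltr_pMr // ltr1n.
move=> /cauchy_cvg/cvg_ex[l ul]; exists l => e e0.
have e0' : 0 < e%:C by rewrite ltcR.
have [N _ uN] := (cvgrPdist_le _ _).1 ul _ e0'.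
exists N => n Nn; rewrite nrm_distC -lecR -nrmE.
exact: uN.
Qed.

End HilbertBasics.

(** * Bounded operators, projections and adjoints *)

Section RealFacts.
Context {R : realType}.

Lemma invS_small (e : R) : 0 < e ->
  exists N, forall n, (N <= n)%N -> n.+1%:R^-1 <= e.
Proof.
move=> e0; have [N _ HN] := near_infty_natSinv_lt (PosNum e0).
by exists N => n Nn; apply/ltW/HN.
Qed.

(** The slack [e / (C + 1)] covers [C = 0] as well. Nearly every limit argument below ends with this
    lemma. *)
Lemma le_epsM (a b C : R) : 0 <= C ->
  (forall e : R, 0 < e -> a <= b + C * e) -> a <= b.
Proof.
move=> C0 ab; apply/ler_addgt0Pr => e e0.
apply: le_trans (ab (e / (C + 1)) _) _; first by rewrite divr_gt0 ?ltr_wpDl.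
rewrite lerD2l mulrCA ler_piMr ?(ltW e0) //.
by rewrite ler_pdivrMr ?mul1r ?lerDl ?ler01 // ltr_wpDl.
Qed.

End RealFacts.

Section BoundedOperators.
Context {R : realType} {H : hilbertType R}.
Implicit Types (T S B : H -> H) (x y : H).

Section LinearFunction.
Variables (T : H -> H) (linT : linear T).

Lemma lin0 : T 0 = 0.
Proof. by have := linT (-1) 0 0; rewrite !scaleN1r oppr0 addr0 addNr. Qed.

Lemma linZ (a : R[i]) x : T (a *: x) = a *: T x.
Proof. by have := linT a x 0; rewrite lin0 !addr0. Qed.

Lemma linD x y : T (x + y) = T x + T y.
Proof. by have := linT 1 x y; rewrite !scale1r. Qed.

Lemma linN x : T (- x) = - T x.
Proof. by rewrite -scaleN1r linZ scaleN1r. Qed.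

Lemma linB x y : T (x - y) = T x - T y.
Proof. by rewrite linD linN. Qed.

Lemma lin_sum (I : Type) (r : seq I) (F : I -> H) :
  T (\sum_(i <- r) F i) = \sum_(i <- r) T (F i).
Proof. by apply: big_morph; [exact: linD | exact: lin0]. Qed.

End LinearFunction.

Lemma bounded_operatorI T (M : R) : linear T ->
  (forall x, nrm (T x) <= M * nrm x) -> bounded_operator T.
Proof.
move=> linT bT; split=> // x.
apply/(@cvgrPdist_le _ _ _ (nbhs x)) => e; rewrite ltcE => /andP[/eqP eI eR].
have M0 : 0 <= `|M| by [].
pose d := complex.Re e / (`|M| + 1).
have d0 : 0 < d by rewrite divr_gt0 // ltr_wpDl.
have d0' : 0 < d%:C by rewrite ltcR.
near=> y.
have xy : `|x - y| <= d%:C by near: y; apply: cvgr_dist_le.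
rewrite -(linB linT) nrmE lecE /= eI eqxx /=.
apply: le_trans (bT _) _; move: xy; rewrite nrmE lecR => xy.
apply: le_trans (_ : `|M| * d <= _).
  apply: le_trans (ler_wpM2l M0 xy).
  by rewrite ler_wpM2r ?nrm_ge0 // ler_norm.
rewrite /d mulrCA ger_pMr //.
by rewrite ler_pdivrMr ?mul1r ?lerDl ?ler01 // ltr_wpDl.
Unshelve. all: by end_near. Qed.

Lemma bounded_operatorP T : bounded_operator T ->
  exists2 M : R, 0 <= M & forall x, nrm (T x) <= M * nrm x.
Proof.
move=> [linT cT].
pose linM := GRing.isLinear.Build R[i] H H *:%R T linT.
pose f : {linear H -> H} := HB.pack T linM.
have /linear_boundedP : bounded_near f (nbhs (0 : H)).
  by apply/linear_bounded_continuous.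
move=> /pinfty_ex_gt0 [M M0 bT].
have ME : M = (complex.Re M)%:C by rewrite RRe_real // gtr0_real.
exists (complex.Re M) => [|x]; first by rewrite -ler0c -ME ltW.
by have := bT x; rewrite ME !nrmE -rmorphM lecR.
Qed.

Let unit_image T : set R :=
  [set complex.Re `|T x| | x in [set x | `|x| <= 1]]%classic.

Let unit_image_ub T (M : R) : 0 <= M -> (forall x, nrm (T x) <= M * nrm x) ->
  ubound (unit_image T) M.
Proof.
move=> M0 bT _ [x /= x1 <-]; apply: le_trans (bT x) _.
by rewrite ler_piMr // -lecR -nrmE.
Qed.

Let unit_image0 T : (unit_image T !=set0)%classic.
Proof. by exists (nrm (T 0)), 0 => //=; rewrite normr0 ler01. Qed.

Lemma opnorm_ge0 T : bounded_operator T -> 0 <= opnorm T.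
Proof.
move=> bT; have [M M0 TM] := bounded_operatorP bT.
have -> : 0 = nrm (T 0) by rewrite (lin0 bT.1) nrm0.
apply: ub_le_sup; first by exists M; apply: unit_image_ub.
by exists 0 => //=; rewrite normr0 ler01.
Qed.

Lemma opnormP T x : bounded_operator T -> nrm (T x) <= opnorm T * nrm x.
Proof.
move=> bT; have [->|x0] := eqVneq x 0.
  by rewrite (lin0 bT.1) nrm0 mulr0.
have [M M0 TM] := bounded_operatorP bT.
have nx : 0 < nrm x by rewrite nrm_gt0.
rewrite -ler_pdivrMr // mulrC.
have -> : (nrm x)^-1 * nrm (T x) = nrm (T ((nrm x)^-1%:C *: x)).
  by rewrite (linZ bT.1) nrmZr ger0_norm // invr_ge0 ltW.
apply: ub_le_sup; first by exists M; apply: unit_image_ub.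
exists ((nrm x)^-1%:C *: x) => //=.
by rewrite nrmE nrmZr ger0_norm ?invr_ge0 ?(ltW nx) // mulVf ?gt_eqF.
Qed.

Lemma opnorm_le T (M : R) : 0 <= M -> (forall x, nrm (T x) <= M * nrm x) ->
  opnorm T <= M.
Proof.
by move=> M0 TM; apply: ge_sup; [exact: unit_image0 | exact: unit_image_ub].
Qed.

Lemma bounded_comp S T : bounded_operator S -> bounded_operator T ->
  bounded_operator (S \o T).
Proof.
move=> bS bT; apply: (@bounded_operatorI _ (opnorm S * opnorm T)) => [a x y|x] /=.
  by rewrite bT.1 bS.1.
apply: le_trans (opnormP _ bS) _; rewrite -mulrA.
by rewrite ler_wpM2l ?opnorm_ge0 // opnormP.
Qed.

Lemma opnorm_comp S T : bounded_operator S -> bounded_operator T ->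
  opnorm (S \o T) <= opnorm S * opnorm T.
Proof.
move=> bS bT; apply: opnorm_le => [|x] /=; first by rewrite mulr_ge0 ?opnorm_ge0.
apply: le_trans (opnormP _ bS) _; rewrite -mulrA.
by rewrite ler_wpM2l ?opnorm_ge0 // opnormP.
Qed.

Lemma bounded_id : bounded_operator (@id H).
Proof. by apply: (@bounded_operatorI _ 1) => // x; rewrite mul1r. Qed.

Lemma bounded_iter T k : bounded_operator T -> bounded_operator (iter k T).
Proof.
move=> bT; elim: k => [|k IH]; first exact: bounded_id.
exact: (@bounded_comp T (iter k T)).
Qed.

Lemma bounded_add S T : bounded_operator S -> bounded_operator T ->
  bounded_operator (fun x => S x + T x).
Proof.
move=> bS bT; apply: (@bounded_operatorI _ (opnorm S + opnorm T)) => [a x y|x] /=.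
  by rewrite bS.1 bT.1 scalerDr addrACA.
by apply: le_trans (nrmD _ _) _; rewrite mulrDl lerD ?opnormP.
Qed.

Lemma bounded_scale (a : R[i]) T : bounded_operator T ->
  bounded_operator (fun x => a *: T x).
Proof.
move=> bT; apply: (@bounded_operatorI _ (cabs a * opnorm T)) => [b x y|x] /=.
  by rewrite bT.1 scalerDr !scalerA (mulrC a).
by rewrite nrmZ -mulrA ler_wpM2l ?cabs_ge0 ?opnormP.
Qed.

Lemma bounded_sub S T : bounded_operator S -> bounded_operator T ->
  bounded_operator (fun x => S x - T x).
Proof.
move=> bS bT; have := bounded_add bS (bounded_scale (-1) bT).
by congr bounded_operator; apply/funext => x; rewrite scaleN1r.
Qed.

Lemma bounded_shift (z : R[i]) T : bounded_operator T ->
  bounded_operator (fun x => z *: x - T x).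
Proof. by move=> bT; apply: bounded_sub (bounded_scale z bounded_id) bT. Qed.

End BoundedOperators.

(** * Orthogonal projection, Riesz representation and criteria for invertibility *)

Section Projection.
Context {R : realType} {H : hilbertType R}.
Implicit Types (K : H -> Prop) (x y : H).

Definition closed_subspace K : Prop :=
  [/\ K 0, forall (a : R[i]) x y, K x -> K y -> K (a *: x + y) &
      forall x, (forall e : R, 0 < e -> exists2 y, K y & nrm (x - y) <= e) -> K x].

(** Moving [k] by the component of [x - k] along [y] lowers the squared distance by [|w|^2 / |y|^2],
    which is thus at most [e ^+ 2]. Allowing near-minimizers lets orthogonality pass to the limit of
    a minimizing sequence. *)
Lemma almost_closest_orthogonal K x k (e : R) : closed_subspace K -> K k ->
  0 <= e ->
  (forall h, K h -> nrm (x - k) ^+ 2 <= nrm (x - h) ^+ 2 + e ^+ 2) ->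
  forall y, K y -> cabs (inner (x - k) y) <= e * nrm y.
Proof.
move=> [K0 Klin _] Kk e0 kmin y Ky; set w := inner (x - k) y.
have [y0|y0] := eqVneq y 0.
  by rewrite /w y0 inner0r /cabs normr0 /= nrm0 mulr0.
have ny : 0 < nrm y by rewrite nrm_gt0.
pose t := (nrm y ^+ 2)^-1.
have t0 : 0 < t by rewrite invr_gt0 exprn_gt0.
have := kmin _ (Klin (t%:C * w) y k Ky Kk).
have -> : x - ((t%:C * w) *: y + k) = (x - k) - (t%:C * w) *: y.
  by rewrite opprD addrA addrAC.
rewrite (nrm_sqrB (x - k)).
have -> : rip (x - k) ((t%:C * w) *: y) = t * cabs w ^+ 2.
  rewrite /rip innerZr conjcM conjc_real -mulrA (mulrC (conjc w)) -/w.
  by rewrite -sqr_normc cabsE -rmorphXn -rmorphM.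
rewrite nrmZ cabsM cabs_real gtr0_norm // => h.
have {}h : t * cabs w ^+ 2 <= e ^+ 2.
  have E : (t * cabs w * nrm y) ^+ 2 = t * cabs w ^+ 2.
    by rewrite !exprMn /t; field; rewrite gt_eqF.
  by move: h; rewrite E; lra.
rewrite -ler_sqr ?nnegrE ?cabs_ge0 ?mulr_ge0 ?(ltW ny) // exprMn.
by rewrite -ler_pdivrMr ?exprn_gt0 // mulrC.
Qed.

(** A minimizing sequence is Cauchy by the parallelogram law, since midpoints stay in [K]. The
    squared error [(n.+1%:R^-1) ^+ 2] is chosen so that [almost_closest_orthogonal] gives
    orthogonality up to [n.+1%:R^-1]. *)
Theorem orthogonal_projection K x : closed_subspace K ->
  exists2 k, K k & forall y, K y -> inner (x - k) y = 0.
Proof.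
move=> clK; have [K0 Klin Kcl] := clK.
pose E := [set nrm (x - k) ^+ 2 | k in [set k | K k]]%classic.
pose D := inf E.
have lbE : has_lbound E by exists 0 => _ [k _ <-]; rewrite exprn_ge0 ?nrm_ge0.
have infE : has_inf E by split => //; exists (nrm (x - 0) ^+ 2), 0.
have D_le h : K h -> D <= nrm (x - h) ^+ 2 by move=> Kh; apply: ge_inf => //; exists h.
have /choice [k kP] : forall n, exists k, K k /\
    nrm (x - k) ^+ 2 <= D + (n.+1%:R^-1) ^+ 2.
  move=> n; have e0 : 0 < (n.+1%:R^-1 : R) ^+ 2 by rewrite exprn_gt0 ?invr_gt0.
  by have [_ [k Kk <-] /ltW] := inf_adherent e0 infE; exists k.
have orth n y : K y -> cabs (inner (x - k n) y) <= n.+1%:R^-1 * nrm y.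
  have [Kk kn] := kP n; apply: almost_closest_orthogonal => // h Kh.
  by apply: le_trans kn _; rewrite lerD2r D_le.
have [|l kl] := @nrm_complete R H k.
  move=> e e0; have [|N HN] := @invS_small R (e / 2); first by rewrite divr_gt0.
  exists N => m n Nm Nn.
  rewrite -ler_sqr ?nnegrE ?nrm_ge0 ?(ltW e0) //.
  have := parallelogram (x - k m) (x - k n).
  have -> : x - k m - (x - k n) = - (k m - k n) by rewrite opprB addrC subrKA opprB.
  have -> : x - k m + (x - k n) = 2%:C *: (x - 2^-1%:C *: (k m + k n)).
    rewrite scalerBr scalerA -rmorphM /= divff ?pnatr_eq0 // scale1r.
    have -> : (2%:C : R[i]) = 1 + 1 by rewrite rmorphD.
    by rewrite scalerDl !scale1r opprD addrACA.
  rewrite nrmZr ger0_norm // nrmN exprMn.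
  have Kmn : K (2^-1%:C *: (k m + k n)).
    rewrite -[X in K X]addr0; apply: (Klin _ _ _ _ K0).
    by rewrite -(scale1r (k m)); exact: (Klin _ _ _ (kP m).1 (kP n).1).
  have := D_le _ Kmn; have := (kP m).2; have := (kP n).2.
  have sq q : (N <= q)%N -> (q.+1%:R^-1 : R) ^+ 2 <= e ^+ 2 / 4.
    move=> Nq; have -> : e ^+ 2 / 4 = (e / 2) ^+ 2 by field.
    by rewrite ler_sqr ?nnegrE ?invr_ge0 ?divr_ge0 ?HN // ltW.
  move: (sq _ Nm) (sq _ Nn).
  have arith (A B M d a b c : R) : a <= c / 4 -> b <= c / 4 -> B <= D + b ->
      A <= D + a -> D <= M -> 2 ^+ 2 * M + d = 2 * (A + B) -> d <= c by lra.
  exact: arith.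
have Kl : K l.
  apply: Kcl => e e0; have [N HN] := kl e e0.
  by exists (k N); [exact: (kP N).1 | rewrite nrm_distC HN].
exists l => // y Ky.
apply/eqP; rewrite -cabs_eq0 eq_le cabs_ge0 andbT.
have ny := nrm_ge0 y.
apply: (@le_epsM _ _ _ (2 * nrm y)); first by rewrite mulr_ge0.
move=> e e0; have [N1 H1] := kl e e0; have [N2 H2] := invS_small e0.
pose N := maxn N1 N2.
have -> : x - l = (x - k N) + (k N - l) by rewrite subrKA.
rewrite innerDl; apply: le_trans (cabsD _ _) _.
have := orth N y Ky.
have := le_trans (cauchy_schwarz (k N - l) y) (ler_wpM2r ny (H1 N (leq_maxl _ _))).
have := ler_wpM2r ny (H2 N (leq_maxr _ _)).
by move: (N.+1%:R^-1 : R) => d; lra.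
Qed.

(** If [f] is nonzero, some [u] outside the kernel is orthogonal to it. As [x - (f x / f u) *: u]
    lies in the kernel, [inner x u] determines [f x]. *)
Theorem riesz (f : H -> R[i]) (M : R) :
  (forall a x y, f (a *: x + y) = a * f x + f y) ->
  (forall x, cabs (f x) <= M * nrm x) ->
  exists v, forall x, f x = inner x v.
Proof.
move=> flin fM.
have [f0|/existsNP[u0 fu0]] := pselect (forall x, f x = 0).
  by exists 0 => x; rewrite f0 inner0r.
have f00 : f 0 = 0 by have := flin (-1) 0 0; rewrite scaleN1r oppr0 addr0 mulN1r addNr.
have fB x y : f (x - y) = f x - f y.
  by rewrite addrC -scaleN1r flin mulN1r addrC.
have fZ a x : f (a *: x) = a * f x by have := flin a x 0; rewrite !addr0 f00 addr0.
have [|k fk ko] := @orthogonal_projection (fun x => f x = 0) u0.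
  split => // [a x y fx fy|x xcl]; first by rewrite flin fx fy mulr0 addr0.
  apply/eqP; rewrite -cabs_eq0 eq_le cabs_ge0 andbT.
  apply: (@le_epsM _ _ _ `|M|) => // e e0; have [y fy xy] := xcl e e0.
  rewrite add0r -[f x]subr0 -fy -fB; apply: le_trans (fM _) _.
  apply: le_trans (ler_wpM2l (normr_ge0 M) xy).
  by rewrite ler_wpM2r ?nrm_ge0 // ler_norm.
pose u := u0 - k.
have fu : f u != 0 by rewrite fB fk subr0; apply/eqP.
have u_neq0 : inner u u != 0.
  rewrite inner_xx -(rmorph0 (real_complex R)) (inj_eq (@complexI R)) sqrf_eq0 nrm_eq0.
  by apply: contraNneq fu => ->; rewrite f00.
exists (conjc (f u / inner u u) *: u) => x.
have /ko : f (x - (f x / f u) *: u) = 0 by rewrite fB fZ divfK ?subrr.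
rewrite -/u innerBr innerZr => /eqP; rewrite subr_eq0 => /eqP E.
rewrite innerZr conjcK (innerC u x) E conjcM conjcK -(innerC u u).
by field; rewrite fu u_neq0.
Qed.

(** Riesz representation of [x |-> inner (T x) y] supplies the operator that [get] needs; its bound
    comes from [|S y|^2 = Re <T (S y), y>]. *)
Lemma adjoint_spec (T : H -> H) : bounded_operator T ->
  bounded_operator (adjoint T) /\
  forall x y, inner (T x) y = inner x (adjoint T y).
Proof.
move=> bT; apply: (@getPex _ [set S | bounded_operator S /\
  forall x y, inner (T x) y = inner x (S y)]%classic).
have /choice [S TS] : forall y, exists v, forall x, inner (T x) y = inner x v.
  move=> y; apply: (@riesz _ (opnorm T * nrm y)) => [a x z|x].
    by rewrite bT.1 innerDl innerZl.
  apply: le_trans (cauchy_schwarz _ _) _.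
  by rewrite mulrAC ler_wpM2r ?nrm_ge0 ?opnormP.
exists S; split=> // ; apply: (@bounded_operatorI _ _ _ (opnorm T)).
  move=> a x y; apply: inner_injr => z.
  by rewrite -TS !innerDr !innerZr !TS.
move=> y; have [->|Sy0] := eqVneq (S y) 0.
  by rewrite nrm0 mulr_ge0 ?opnorm_ge0 ?nrm_ge0.
rewrite -nrm_gt0 in Sy0; rewrite -(ler_pM2l Sy0) -expr2.
have -> : nrm (S y) ^+ 2 = rip (T (S y)) y by rewrite /rip TS inner_xx.
apply: le_trans (ler_norm _) _; apply: le_trans (rip_le _ _) _.
by rewrite mulrA (mulrC (nrm (S y))) ler_wpM2r ?nrm_ge0 ?opnormP.
Qed.

(** For [B = z - T] this is exactly the statement that [spectrum] negates. *)
Definition invertible_op (B : H -> H) : Prop :=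
  exists S, [/\ bounded_operator S, forall x, S (B x) = x & forall x, B (S x) = x].

(** The lower bound makes preimages of a Cauchy sequence Cauchy, so the range is closed. The
    residual of a projection onto the range is orthogonal to it, hence zero, so [B] is onto. *)
Lemma bounded_below_invertible (B : H -> H) (C : R) : bounded_operator B ->
  0 <= C -> (forall x, nrm x <= C * nrm (B x)) ->
  (forall y, (forall x, inner y (B x) = 0) -> y = 0) -> invertible_op B.
Proof.
move=> bB C0 below dense.
have surj y : exists x, B x = y.
  have [|k [x <-] ko] := @orthogonal_projection (fun z => exists x, B x = z) y.
    split=> [|a _ _ [x <-] [z <-]|z zcl]; first by exists 0; rewrite (lin0 bB.1).
      by exists (a *: x + z); rewrite bB.1.
    have /choice [u uz] : forall n, exists u, nrm (z - B u) <= n.+1%:R^-1.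
      move=> n; have n0 : 0 < n.+1%:R^-1 :> R by rewrite invr_gt0.
      by have [_ [u <-]] := zcl _ n0; exists u.
    have [|l ul] := @nrm_complete _ _ u.
      move=> e e0; have [|N HN] := @invS_small R (e / (2 * (C + 1))).
        by rewrite divr_gt0 // mulr_gt0 // ltr_wpDl.
      exists N => m n Nm Nn; apply: le_trans (below _) _; rewrite (linB bB.1).
      have := nrm_distD z (B (u m)) (B (u n)); rewrite (nrm_distC (B _) z) => h.
      have := le_trans (uz m) (HN _ Nm); have := le_trans (uz n) (HN _ Nn).
      move=> hn hm; apply: le_trans (_ : C * (e / (C + 1)) <= _).
        rewrite ler_wpM2l //; apply: le_trans h _; apply: le_trans (lerD hm hn) _.
        suff -> : e / (C + 1) = e / (2 * (C + 1)) + e / (2 * (C + 1)) by [].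
        by field; rewrite gt_eqF // ltr_wpDl.
      rewrite mulrCA ger_pMr // ler_pdivrMr ?mul1r ?lerDl //.
      by rewrite ltr_wpDl.
    exists l; apply/eqP; rewrite -subr_eq0 -nrm_eq0 eq_le nrm_ge0 andbT.
    have M0 := opnorm_ge0 bB.
    apply: (@le_epsM _ _ _ (opnorm B + 1)); first by rewrite addr_ge0.
    move=> e e0; have [N1 H1] := ul e e0; have [N2 H2] := invS_small e0.
    pose N := maxn N1 N2; rewrite add0r.
    apply: le_trans (nrm_distD (B (u N)) _ _) _; rewrite mulrDl mul1r lerD //.
      rewrite -(linB bB.1); apply: le_trans (opnormP _ bB) _.
      by rewrite ler_wpM2l // nrm_distC H1 ?leq_maxl.
    by rewrite nrm_distC; apply: le_trans (uz _) _; rewrite H2 ?leq_maxr.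
  exists x; apply/esym/eqP; rewrite -subr_eq0; apply/eqP/dense => z.
  by apply: ko; exists z.
have inj x y : B x = B y -> x = y.
  move=> Bxy; apply/eqP; rewrite -subr_eq0 -nrm_eq0 eq_le nrm_ge0 andbT.
  by apply: le_trans (below _) _; rewrite (linB bB.1) Bxy subrr nrm0 mulr0.
have [S BS] := choice surj.
exists S; split=> // [|x]; last exact: inj.
apply: (@bounded_operatorI _ _ _ C) => [a x y|x].
  by apply: inj; rewrite bB.1 !BS.
by have := below (S x); rewrite BS.
Qed.

(** A form of Lax-Milgram. The factor [c] turns the numerical range of [B] into a right half-plane;
    each localization of a spectrum below is a choice of [c]. *)
Lemma coercive_invertible (B : H -> H) (c : R[i]) (m : R) : bounded_operator B ->
  0 < m -> (forall x, m * nrm x ^+ 2 <= complex.Re (c * inner (B x) x)) ->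
  invertible_op B.
Proof.
move=> bB m0 co; apply: (@bounded_below_invertible _ (cabs c / m)) => //.
- by rewrite divr_ge0 ?cabs_ge0 ?ltW.
- move=> x; have [->|x0] := eqVneq x 0.
    by rewrite nrm0 !mulr_ge0 ?cabs_ge0 ?nrm_ge0 // invr_ge0 ltW.
  rewrite -nrm_gt0 in x0; rewrite mulrAC ler_pdivlMr // -(ler_pM2r x0).
  rewrite -mulrA mulrCA -expr2; apply: le_trans (co x) _.
  apply: le_trans (ler_norm _) _; apply: le_trans (Re_le_cabs _) _.
  by rewrite cabsM -mulrA ler_wpM2l ?cabs_ge0 // cauchy_schwarz.
- move=> y yB; have := co y; rewrite innerC yB conjc0 mulr0 /=.
  rewrite pmulr_rle0 // => h; apply/eqP; rewrite -nrm_eq0 -sqrf_eq0.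
  by rewrite eq_le h exprn_ge0 ?nrm_ge0.
Qed.

Lemma invertible_comp (B C : H -> H) :
  invertible_op B -> invertible_op C -> invertible_op (B \o C).
Proof.
move=> [S [bS SB BS]] [T [bT TC CT]]; exists (T \o S); split=> [|x|x] /=.
- exact: bounded_comp.
- by rewrite SB TC.
- by rewrite CT BS.
Qed.

End Projection.

(** * Spectrum and polynomial calculus *)

Section Spectrum.
Context {R : realType} {H : hilbertType R}.
Implicit Types (T A : H -> H) (x y : H) (z : R[i]).

Lemma not_spectrum T z : ~ spectrum T z ->
  invertible_op (fun x => z *: x - T x).
Proof. exact: contrapT. Qed.

Lemma spectrum_le T z : bounded_operator T -> spectrum T z -> cabs z <= opnorm T.
Proof.
move=> bT sz; rewrite leNgt; apply/negP => Tz; apply: sz.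
have z0 : 0 < cabs z := le_lt_trans (opnorm_ge0 bT) Tz.
(* With [c = conjc z] the term [z *: x] contributes [|z|^2 |x|^2], and [T] takes away at most
   [|z| ||T|| |x|^2]. *)
apply: (@coercive_invertible _ _ _ (conjc z) (cabs z * (cabs z - opnorm T))).
- exact: bounded_shift.
- by rewrite mulr_gt0 // subr_gt0.
move=> x; rewrite innerBl innerZl [conjc z * _]mulrBr cReD cReN [conjc z * _]mulrA (mulrC (conjc z)).
rewrite -sqr_normc cabsE inner_xx -rmorphXn -rmorphM /=.
rewrite mulrBr mulrBl -expr2 lerD2l lerN2.
apply: le_trans (ler_norm _) _; apply: le_trans (Re_le_cabs _) _.
rewrite cabsM cabs_conj -mulrA ler_wpM2l ?cabs_ge0 //.
apply: le_trans (cauchy_schwarz _ _) _.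
by rewrite expr2 mulrA ler_wpM2r ?nrm_ge0 ?opnormP.
Qed.

Definition selfadjoint A : Prop := forall x y, inner (A x) y = inner x (A y).

Definition positive_op A : Prop :=
  [/\ bounded_operator A, selfadjoint A & forall x, 0 <= rip (A x) x].

Lemma selfadjoint_Im A x : selfadjoint A -> complex.Im (inner (A x) x) = 0.
Proof.
move=> sA; have := innerC x (A x); rewrite sA => /(congr1 (@complex.Im R)).
by case: (inner x (A x)) => a b /=; lra.
Qed.

Lemma spectrum_selfadjoint_Im A z : bounded_operator A -> selfadjoint A ->
  spectrum A z -> complex.Im z = 0.
Proof.
move=> bA sA sz; apply/eqP/negPn/negP => z0; apply: sz.
(* Since [<A x, x>] is real, multiplying by [-i Im z] leaves [(Im z)^2 |x|^2] as the real part. *)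
apply: (@coercive_invertible _ _ _ (0 -i* complex.Im z) (complex.Im z ^+ 2)).
- exact: bounded_shift.
- by rewrite exprn_even_gt0.
move=> x; rewrite innerBl innerZl inner_xx cReM /= mul0r cImD cImN selfadjoint_Im //.
rewrite cImM /= mulr0 add0r; lra.
Qed.

Lemma spectrum_selfadjoint A z : bounded_operator A -> selfadjoint A ->
  spectrum A z -> z = (complex.Re z)%:C.
Proof.
move=> bA sA /(spectrum_selfadjoint_Im bA sA); by case: z => a b /= ->.
Qed.

Lemma spectrum_positive A (t : R) : positive_op A -> spectrum A t%:C -> 0 <= t.
Proof.
move=> [bA sA pA] st; rewrite leNgt; apply/negP => t0; apply: st.
apply: (@coercive_invertible _ _ _ (-1) (- t)).
- exact: bounded_shift.
- by rewrite oppr_gt0.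
move=> x; rewrite innerBl innerZl inner_xx mulN1r opprB cReD cReN -rmorphM /=.
by have := pA x; rewrite /rip; lra.
Qed.

End Spectrum.

(** * Polynomials of an operator and their norms in the self-adjoint case *)

Section PolynomialCalculus.
Context {R : realType} {H : hilbertType R}.
Implicit Types (A : H -> H) (x y : H).

(** Complex coefficients, unlike those of [poly_op], allow splitting into linear factors. *)
Definition cpoly_op (q : {poly R[i]}) A : H -> H :=
  fun x => \sum_(i < size q) q`_i *: iter i A x.

Lemma cpoly_op_wide (q : {poly R[i]}) A n x : (size q <= n)%N ->
  cpoly_op q A x = \sum_(i < n) q`_i *: iter i A x.
Proof.
move=> qn; rewrite /cpoly_op (big_ord_widen n (fun i => q`_i *: iter i A x)) //.
rewrite big_mkcond; apply: eq_bigr => i _; case: ltnP => // /(nth_default 0) ->.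
by rewrite scale0r.
Qed.

Lemma cpoly_opD (p q : {poly R[i]}) A x :
  cpoly_op (p + q) A x = cpoly_op p A x + cpoly_op q A x.
Proof.
rewrite !(@cpoly_op_wide _ A (maxn (size p) (size q))) ?leq_maxl ?leq_maxr //.
  by rewrite -big_split; apply: eq_bigr => i _; rewrite coefD scalerDl.
exact: size_polyD.
Qed.

Lemma cpoly_opZ (a : R[i]) (p : {poly R[i]}) A x :
  cpoly_op (a *: p) A x = a *: cpoly_op p A x.
Proof.
rewrite (@cpoly_op_wide _ A (size p)) ?size_scale_leq // scaler_sumr.
by apply: eq_bigr => i _; rewrite coefZ scalerA.
Qed.

Lemma cpoly_opC (a : R[i]) A x : cpoly_op a%:P A x = a *: x.
Proof.
rewrite (@cpoly_op_wide _ A 1) ?size_polyC ?leq_b1 //.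
by rewrite big_ord1 coefC.
Qed.

Lemma cpoly_opMX (p : {poly R[i]}) A x : bounded_operator A ->
  cpoly_op (p * 'X) A x = A (cpoly_op p A x).
Proof.
move=> bA; rewrite (@cpoly_op_wide _ A (size p).+1).
  rewrite big_ord_recl coefMX scale0r add0r (lin_sum bA.1).
  by apply: eq_bigr => i _; rewrite coefMX /= (linZ bA.1).
have [->|p0] := eqVneq p 0; first by rewrite mul0r size_poly0.
by rewrite size_mulX.
Qed.

Lemma cpoly_opM (p q : {poly R[i]}) A x : bounded_operator A ->
  cpoly_op (p * q) A x = cpoly_op p A (cpoly_op q A x).
Proof.
move=> bA; elim/poly_ind: p => [|p c IH].
  by rewrite mul0r -[0]/(0%:P) !cpoly_opC !scale0r.
rewrite mulrDl cpoly_opD mul_polyC cpoly_opZ mulrAC cpoly_opMX // IH.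
by rewrite cpoly_opD cpoly_opC cpoly_opMX.
Qed.

Lemma cpoly_opX A x : bounded_operator A -> cpoly_op 'X A x = A x.
Proof. by move=> bA; rewrite -[X in cpoly_op X]mul1r cpoly_opMX // cpoly_opC scale1r. Qed.

Lemma bounded_cpoly (p : {poly R[i]}) A : bounded_operator A ->
  bounded_operator (cpoly_op p A).
Proof.
move=> bA; elim/poly_ind: p => [|p c IH].
  have := bounded_scale 0 (@bounded_id R H); congr bounded_operator.
  by apply/funext => x; rewrite -[0%R in RHS]/(0%:P) cpoly_opC.
have := bounded_add (bounded_comp bA IH) (bounded_scale c (@bounded_id R H)).
congr bounded_operator; apply/funext => x /=.
by rewrite cpoly_opD cpoly_opC cpoly_opMX.
Qed.

Lemma invertible_scale (a : R[i]) (B : H -> H) : a != 0 -> bounded_operator B ->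
  invertible_op B -> invertible_op (fun x => a *: B x).
Proof.
move=> a0 bB [S [bS SB BS]]; exists (fun x => S (a^-1 *: x)); split=> [|x|x].
- exact: (bounded_comp bS (bounded_scale a^-1 (@bounded_id R H))).
- by rewrite scalerA mulVf // scale1r SB.
- by rewrite BS scalerA divff // scale1r.
Qed.

Lemma invertible_id : invertible_op (@id H).
Proof. by exists id; split=> //; exact: bounded_id. Qed.

(** Induction on the degree, splitting off one root at a time: each factor is invertible because its
    root is outside the spectrum. *)
Lemma cpoly_invertible (q : {poly R[i]}) A : bounded_operator A -> q != 0 ->
  (forall z, root q z -> ~ spectrum A z) -> invertible_op (cpoly_op q A).
Proof.
move=> bA; have [n] := ubnP (size q); elim: n q => // n IH q sq q0 qA.
have [sq1|/closed_rootP[z qz]] := eqVneq (size q) 1.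
  have /size_poly1P[c c0 ->] : size q == 1 by apply/eqP.
  have := invertible_scale c0 (@bounded_id R H) invertible_id.
  by congr invertible_op; apply/funext => x; rewrite cpoly_opC.
have [q1 qE] := factor_theorem _ _ qz.
have q10 : q1 != 0 by apply: contraNneq q0 => q10; rewrite qE q10 mul0r.
(* The factor ['X - z] evaluates to [A - z], whereas the spectrum speaks of [z - A]; hence the
   scalar [-1]. *)
have -> : cpoly_op q A =
    cpoly_op q1 A \o (fun x => -1 *: (fun x => z *: x - A x) x).
  apply/funext => x /=; rewrite qE cpoly_opM //; congr cpoly_op.
  rewrite cpoly_opD cpoly_opX // -polyCN cpoly_opC.
  by rewrite scaleN1r opprB scaleNr.
apply: invertible_comp.
  apply: IH => // [|w q1w]; last by apply: qA; rewrite qE rootM q1w.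
  by move: sq; rewrite qE size_Mmonic ?monicXsubC // size_XsubC addn2.
apply: invertible_scale; first by rewrite oppr_eq0 oner_eq0.
  exact: bounded_shift.
exact/not_spectrum/qA.
Qed.

Lemma poly_opE (p : {poly R}) A :
  poly_op p A = cpoly_op (map_poly (real_complex R) p) A.
Proof.
apply/funext => x; rewrite /poly_op /cpoly_op size_map_poly.
by apply: eq_bigr => i _; rewrite coef_map.
Qed.

Lemma bounded_poly_op (p : {poly R}) A : bounded_operator A ->
  bounded_operator (poly_op p A).
Proof. by rewrite poly_opE; exact: bounded_cpoly. Qed.

Lemma poly_opB (p q : {poly R}) A x :
  poly_op (p - q) A x = poly_op p A x - poly_op q A x.
Proof.
by rewrite !poly_opE rmorphB /= cpoly_opD -scaleN1r cpoly_opZ scaleN1r.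
Qed.

Lemma poly_opM (p q : {poly R}) A x : bounded_operator A ->
  poly_op (p * q) A x = poly_op p A (poly_op q A x).
Proof. by move=> bA; rewrite !poly_opE rmorphM /= cpoly_opM. Qed.

Lemma poly_opX A x : bounded_operator A -> poly_op 'X A x = A x.
Proof. by move=> bA; rewrite poly_opE map_polyX cpoly_opX. Qed.

Lemma selfadjoint_iter A i : selfadjoint A -> selfadjoint (iter i A).
Proof. by move=> sA; elim: i => [|i IH] x y //; rewrite iterS sA IH -iterSr. Qed.

Lemma inner_suml (I : Type) (r : seq I) (F : I -> H) y :
  inner (\sum_(i <- r) F i) y = \sum_(i <- r) inner (F i) y.
Proof.
by apply: (big_morph (fun x => inner x y)) => [a b|]; rewrite ?innerDl ?inner0l.
Qed.

Lemma inner_sumr (I : Type) (r : seq I) (F : I -> H) y :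
  inner y (\sum_(i <- r) F i) = \sum_(i <- r) inner y (F i).
Proof.
by apply: (big_morph (fun x => inner y x)) => [a b|]; rewrite ?innerDr ?inner0r.
Qed.

Lemma selfadjoint_poly_op (p : {poly R}) A : selfadjoint A ->
  selfadjoint (poly_op p A).
Proof.
move=> sA x y; rewrite /poly_op inner_suml inner_sumr; apply: eq_bigr => i _.
by rewrite innerZl innerZr conjc_real (selfadjoint_iter i sA).
Qed.

(* If [N^2 - B^2] had a bounded inverse then [N^2 |x|^2 - |Bx|^2] would be
   bounded below by a multiple of [|x|^2], against the definition of [N]. *)
Lemma opnorm_sqr_not_invertible (B : H -> H) : (exists x : H, x != 0) ->
  bounded_operator B -> selfadjoint B ->
  ~ invertible_op (fun x => (opnorm B ^+ 2)%:C *: x - B (B x)).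
Proof.
move=> [v v0] bB sB [S [bS SB _]]; set N := opnorm B in SB *.
have N0 : 0 <= N := opnorm_ge0 bB.
pose K := opnorm S + 1.
have K0 : 0 < K by rewrite ltr_wpDl ?opnorm_ge0.
(* Expand the square of [|x| <= K |N^2 x - B (B x)|] and use [|B (B x)| <= N |B x|]. *)
have low x : nrm x ^+ 2 <= K ^+ 2 * (N ^+ 2 * (N ^+ 2 * nrm x ^+ 2 - nrm (B x) ^+ 2)).
  have h : nrm x <= K * nrm ((N ^+ 2)%:C *: x - B (B x)).
    have := opnormP ((N ^+ 2)%:C *: x - B (B x)) bS.
    by rewrite SB /K mulrDl mul1r => /le_trans; apply; rewrite lerDl nrm_ge0.
  have {h} := h; rewrite -ler_sqr ?nnegrE ?mulr_ge0 ?nrm_ge0 ?(ltW K0) // exprMn.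
  move=> /le_trans; apply; rewrite ler_wpM2l ?exprn_ge0 ?(ltW K0) //.
  rewrite nrm_sqrB nrmZr ger0_norm ?exprn_ge0 //.
  have -> : rip ((N ^+ 2)%:C *: x) (B (B x)) = N ^+ 2 * nrm (B x) ^+ 2.
    by rewrite /rip innerZl -sB inner_xx -rmorphM.
  have : nrm (B (B x)) ^+ 2 <= (N * nrm (B x)) ^+ 2.
    by rewrite lerXn2r ?nnegrE ?mulr_ge0 ?nrm_ge0 // opnormP.
  by rewrite !exprMn; lra.
have Ngt0 : 0 < N.
  rewrite lt_def N0 andbT; apply/eqP => Nz; have := low v.
  rewrite Nz expr0n /= !mul0r mulr0 => h; move: v0; rewrite -nrm_eq0 -sqrf_eq0.
  by rewrite eq_le h exprn_ge0 ?nrm_ge0.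
(* With this [e], [low] reads [|B x|^2 <= (N^2 - e) |x|^2], so that the norm of [B] would be less
   than [N]. *)
pose e := ((K * N) ^+ 2)^-1.
have e0 : 0 < e by rewrite invr_gt0 exprn_gt0 // mulr_gt0.
have low2 x : nrm (B x) ^+ 2 <= (N ^+ 2 - e) * nrm x ^+ 2.
  have := low x; rewrite mulrA -exprMn -[X in _ <= X * _]invrK -/e.
  by rewrite mulrC ler_pdivlMr //; lra.
have Ne0 : 0 <= N ^+ 2 - e.
  have := low2 v; have : 0 < nrm v ^+ 2 by rewrite exprn_gt0 // nrm_gt0.
  move=> v2 h; rewrite -(pmulr_lge0 _ v2); apply: le_trans h.
  by rewrite exprn_ge0 ?nrm_ge0.
have : N <= Num.sqrt (N ^+ 2 - e).
  apply: opnorm_le => [|x]; first exact: sqrtr_ge0.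
  rewrite -ler_sqr ?nnegrE ?mulr_ge0 ?nrm_ge0 ?sqrtr_ge0 // exprMn.
  by rewrite sqr_sqrtr.
rewrite -ler_sqr ?nnegrE ?sqrtr_ge0 // sqr_sqrtr //.
by rewrite lerDl oppr_ge0 leNgt e0.
Qed.

Context (H_neq0 : exists x : H, x != 0).

(** The operator [N^2 - p(A)^2] is not invertible, so [N^2 - p^2], if nonzero, has a root in the
    spectrum; the root is real, and there [|p| = N]. *)
Lemma opnorm_poly_attained (p : {poly R}) A : bounded_operator A -> selfadjoint A ->
  (opnorm (poly_op p A) ^+ 2)%:P - p ^+ 2 != 0 ->
  exists2 t : R, spectrum A t%:C & `|p.[t]| = opnorm (poly_op p A).
Proof.
move=> bA sA; set N := opnorm _; set q := _ - _ => q0.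
have N0 : 0 <= N := opnorm_ge0 (bounded_poly_op p bA).
have [[z qz Az]|no] := pselect (exists2 z,
    root (map_poly (real_complex R) q) z & spectrum A z).
  move: qz; rewrite (spectrum_selfadjoint bA sA Az) => qz.
  exists (complex.Re z); first by rewrite -(spectrum_selfadjoint bA sA Az).
  move: qz; rewrite rootE horner_map /= -(rmorph0 (real_complex R)).
  rewrite (inj_eq (@complexI R)) !hornerE subr_eq0 => /eqP E.
  by rewrite -(sqrtr_sqr p.[_]) -E sqrtr_sqr ger0_norm.
have := @opnorm_sqr_not_invertible (poly_op p A) H_neq0 (bounded_poly_op p bA)
  (selfadjoint_poly_op p sA).
case; have := @cpoly_invertible (map_poly (real_complex R) q) A bA.
rewrite map_poly_eq0 => /(_ q0) []; first by move=> z qz Az; apply: no; exists z.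
move=> S [bS SB BS]; exists S.
have E x : cpoly_op (map_poly (real_complex R) q) A x =
    (N ^+ 2)%:C *: x - poly_op p A (poly_op p A x).
  rewrite -poly_opE poly_opB expr2 poly_opM // poly_opE map_polyC cpoly_opC.
  by [].
by split=> // x; rewrite -E.
Qed.

Lemma spectrum_selfadjoint_nonempty A : bounded_operator A -> selfadjoint A ->
  exists t : R, spectrum A t%:C.
Proof.
move=> bA sA; have [|t At _] := @opnorm_poly_attained 'X A bA sA; last by exists t.
apply/eqP => /(congr1 (fun q : {poly R} => q`_2)).
by rewrite coefB coefC coefXn coef0 /=; lra.
Qed.

Theorem opnorm_poly_le (p : {poly R}) A (c : R) : bounded_operator A ->
  selfadjoint A -> (forall t : R, spectrum A t%:C -> `|p.[t]| <= c) ->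
  opnorm (poly_op p A) <= c.
Proof.
move=> bA sA pc.
have [q0|/(opnorm_poly_attained bA sA)[t At <-]] :=
  eqVneq ((opnorm (poly_op p A) ^+ 2)%:P - p ^+ 2) 0; last exact: pc.
(* Here [p ^+ 2] is constant, so any point of the spectrum attains the norm. *)
have [t At] := spectrum_selfadjoint_nonempty bA sA.
move: q0 => /(congr1 (fun q => q.[t])); rewrite !hornerE => /eqP.
rewrite subr_eq0 => /eqP E; apply: le_trans (pc _ At).
by rewrite -(sqrtr_sqr p.[t]) -E sqrtr_sqr ler_norm.
Qed.

End PolynomialCalculus.

(** * Uniform approximation of powers *)

Section Bernstein.
Context {R : realType}.
Implicit Types (f g : nat -> R) (x : R).

(* [bernstein n g] is [\sum_k 'C(n, k) g(k) X^k (1 - X)^(n - k)], the expected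
   value of [g] at the number of successes in [n] trials. *)
Fixpoint bernstein n g : {poly R} :=
  if n is m.+1 then 'X * bernstein m (g \o succn) + (1 - 'X) * bernstein m g
  else (g 0)%:P.

Lemma bernstein_horner n g x : (bernstein n.+1 g).[x] =
  x * (bernstein n (g \o succn)).[x] + (1 - x) * (bernstein n g).[x].
Proof. by rewrite /= !hornerE. Qed.

Lemma bernstein_le n f g x : 0 <= x <= 1 ->
  (forall k, (k <= n)%N -> f k <= g k) ->
  (bernstein n f).[x] <= (bernstein n g).[x].
Proof.
move=> /andP[x0 x1]; elim: n f g => [|n IH] f g fg.
  by rewrite /= !hornerE fg.
rewrite !bernstein_horner lerD // ler_wpM2l ?subr_ge0 // IH // => k kn.
  exact: fg.
exact/fg/ltnW.
Qed.

(** These are the first two moments of the binomial law. Induction works for all quadratics at once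
    because they are stable under [k |-> k.+1]. *)
Lemma bernstein_quadratic n g x (a b c : R) :
  (forall k, g k = a + b * k%:R + c * k%:R ^+ 2) ->
  (bernstein n g).[x] =
    a + b * (n%:R * x) + c * (n%:R * x + n%:R * (n%:R - 1) * x ^+ 2).
Proof.
elim: n g a b c => [|n IH] g a b c gE; first by rewrite /= hornerC gE /=; ring.
rewrite bernstein_horner (IH g a b c) // (IH _ (a + b + c) (b + 2 * c) c).
  by rewrite -natr1; ring.
by move=> k /=; rewrite gE -natr1; ring.
Qed.

(** Around [x] the hypothesis encloses [f] between two quadratics, whose Bernstein values are
    explicit; the variance [x (1 - x) / n.+1] gives the term [C * n.+1%:R^-1]. *)
Lemma bernstein_error (f : R -> R) (e C : R) n x : 0 <= x <= 1 -> 0 <= C ->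
  (forall y z, 0 <= y -> 0 <= z -> `|f y - f z| <= e + C * (y - z) ^+ 2) ->
  `|(bernstein n.+1 (fun k => f (k%:R / n.+1%:R))).[x] - f x| <= e + C * n.+1%:R^-1.
Proof.
move=> x01 C0 fmod; have /andP[x0 x1] := x01.
set d : R := n.+1%:R^-1; have d0 : 0 < d by rewrite invr_gt0.
have nd : n.+1%:R * d = 1 by rewrite mulfV.
(* The sign [s] is [1] for the upper quadratic and [-1] for the lower one. *)
have quad s : (bernstein n.+1 (fun k => f x + s * (e + C * (k%:R * d - x) ^+ 2))).[x]
    = f x + s * (e + C * d * (x - x ^+ 2)).
  rewrite (@bernstein_quadratic _ _ _ (f x + s * (e + C * x ^+ 2))
     (- 2 * s * C * x * d) (s * C * d ^+ 2)); last by move=> k; ring.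
  have -> : - 2 * s * C * x * d * (n.+1%:R * x) = - 2 * s * C * x ^+ 2 * (n.+1%:R * d) by ring.
  have -> : s * C * d ^+ 2 * (n.+1%:R * x + n.+1%:R * (n.+1%:R - 1) * x ^+ 2) =
    s * C * ((n.+1%:R * d) * d * x + (n.+1%:R * d) * (n.+1%:R * d - d) * x ^+ 2) by ring.
  by rewrite nd; ring.
have small : C * d * (x - x ^+ 2) <= C * d.
  by rewrite ler_piMr ?mulr_ge0 ?(ltW d0) //; nra.
have fk k : `|f (k%:R * d) - f x| <= e + C * (k%:R * d - x) ^+ 2.
  by apply: fmod => //; rewrite mulr_ge0 ?(ltW d0).
have up : (bernstein n.+1 (fun k => f (k%:R * d))).[x] <= f x + (e + C * d).
  apply: le_trans (bernstein_le (g := fun k => f x + 1 * (e + C * (k%:R * d - x) ^+ 2)) x01 _) _.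
    by move=> k _; have := fk k; rewrite ler_norml mul1r => /andP[_]; lra.
  by rewrite (quad 1); lra.
have lo : f x - (e + C * d) <= (bernstein n.+1 (fun k => f (k%:R * d))).[x].
  apply: le_trans (bernstein_le (f := fun k => f x + -1 * (e + C * (k%:R * d - x) ^+ 2)) x01 _).
    by rewrite (quad (-1)); lra.
  by move=> k _; have := fk k; rewrite ler_norml mulN1r => /andP[]; lra.
by rewrite ler_norml; lra.
Qed.

End Bernstein.

Section PowerModulus.
Context {R : realType}.
Implicit Types (a b s x y : R).

(** The fractions [a / (a + b)] and [b / (a + b)] sum to 1, and each is at most its own power of
    exponent [s]. *)
Lemma powR_subadditive a b s : 0 <= a -> 0 <= b -> s <= 1 ->
  (a + b) `^ s <= a `^ s + b `^ s.
Proof.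
move=> a0 b0 s1; have [ab0|ab0] := eqVneq (a + b) 0.
  have -> : a = 0 by lra.
  by rewrite add0r lerDr powR_ge0.
have S0 : 0 < a + b by rewrite lt_def ab0 addr_ge0.
have le_pow p : 0 <= p <= a + b -> p / (a + b) <= (p / (a + b)) `^ s.
  move=> /andP[p0 pS]; have [->|p_neq0] := eqVneq p 0.
    by rewrite mul0r powR_ge0.
  have p_gt0 : 0 < p by rewrite lt_def p_neq0.
  by apply: ger1_powR => //; rewrite divr_gt0 //= ler_pdivrMr // mul1r.
have ha := le_pow a; have hb := le_pow b.
have one : 1 <= (a / (a + b)) `^ s + (b / (a + b)) `^ s.
  have <- : a / (a + b) + b / (a + b) = 1 by rewrite -mulrDl divff.
  by rewrite lerD ?ha ?hb //; apply/andP; split; lra.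
have Ss : 0 <= (a + b) `^ s by exact: powR_ge0.
have := ler_wpM2r Ss one; rewrite mul1r mulrDl -!powRM ?divr_ge0 ?(ltW S0) //.
by rewrite !divfK.
Qed.

Lemma powR_modulus s (e : R) : 0 <= s <= 1 -> 0 < e -> exists2 C, 0 <= C &
  forall x y, 0 <= x -> 0 <= y -> `|x `^ s - y `^ s| <= e + C * (x - y) ^+ 2.
Proof.
move=> /andP[s0 s1] e0; have [->|sn0] := eqVneq s 0.
  exists 0 => // x y _ _; by rewrite !powRr0 subrr normr0 mul0r addr0 ltW.
have sp : 0 < s by rewrite lt_def sn0.
pose d := e `^ s^-1; have d0 : 0 < d by exact: powR_gt0.
have ds : d `^ s = e by rewrite /d -powRrM mulVf // powRr1 ?ltW.
pose C := 1 + (d ^+ 2)^-1; have iC : 0 < (d ^+ 2)^-1 by rewrite invr_gt0 exprn_gt0.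
have pow_le u : 0 <= u -> u `^ s <= e + C * u ^+ 2.
  move=> u0; have u2 : 0 <= u ^+ 2 by rewrite exprn_ge0.
  have [ud|du] := leP u d.
    apply: le_trans (_ : e <= _); last by rewrite lerDl mulr_ge0 // addr_ge0 // ltW.
    by rewrite -ds ge0_ler_powR ?nnegrE // ltW.
  have ud2 : 1 <= (d ^+ 2)^-1 * u ^+ 2.
    rewrite mulrC ler_pdivlMr ?exprn_gt0 // mul1r.
    by rewrite lerXn2r ?nnegrE // ltW.
  have us : u `^ s <= 1 + u ^+ 2.
    have [u1|u1] := leP u 1.
      apply: le_trans (_ : 1 <= _); last by rewrite lerDl.
      by apply: le_trans (ge0_ler_powR s0 _ _ u1) _; rewrite ?nnegrE ?powR1.
    by apply: le_trans (ler1_powR (ltW u1) s1) _; nra.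
  by rewrite /C mulrDl mul1r; lra.
exists C => [|x y]; first by rewrite addr_ge0 // ltW.
have half v w : 0 <= w -> w <= v -> `|v `^ s - w `^ s| <= e + C * (v - w) ^+ 2.
  move=> w0 wv; rewrite ger0_norm; last first.
    by rewrite subr_ge0 ge0_ler_powR ?nnegrE // (le_trans w0).
  apply: le_trans (pow_le (v - w) _); last by rewrite subr_ge0.
  by rewrite lerBlDr -[v in leLHS](subrK w) powR_subadditive // subr_ge0.
move=> x0 y0; have [xy|/ltW yx] := leP x y; last exact: half.
by rewrite distrC -(sqrrN (x - y)) opprB half.
Qed.

Lemma powR_poly_approx s (M e : R) : 0 <= s <= 1 -> 0 < M -> 0 < e ->
  exists p : {poly R}, forall t, 0 <= t <= M -> `|p.[t] - t `^ s| <= e.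
Proof.
move=> s01 M0 e0; have Ms0 : 0 < M `^ s by exact: powR_gt0.
pose e' := e / (2 * M `^ s); have e'0 : 0 < e' by rewrite divr_gt0 // mulr_gt0.
have [C C0 modC] := powR_modulus s01 e'0.
have [|n nP] := @invS_small R (e' / (C + 1)); first by rewrite divr_gt0 // ltr_wpDl.
pose b := bernstein n.+1 (fun k => (k%:R / n.+1%:R) `^ s).
exists (M `^ s *: (b \Po (M^-1 *: 'X))) => t /andP[t0 tM].
have tM01 : 0 <= t / M <= 1.
  by rewrite divr_ge0 ?(ltW M0) //= ler_pdivrMr // mul1r.
rewrite hornerZ horner_comp hornerZ hornerX (mulrC M^-1).
have -> : t `^ s = M `^ s * (t / M) `^ s.
  by rewrite -powRM ?(ltW M0) //; [rewrite mulrCA divff ?mulr1 // gt_eqF | case/andP: tM01].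
rewrite -mulrBr normrM gtr0_norm //.
have := bernstein_error n tM01 C0 modC; rewrite -/b => h.
have Cn : C * n.+1%:R^-1 <= e'.
  apply: le_trans (ler_wpM2l C0 (nP n (leqnn n))) _.
  rewrite mulrCA ger_pMr // ler_pdivrMr ?mul1r ?lerDl //.
  by rewrite ltr_wpDl.
have -> : e = M `^ s * (e' + e').
  by rewrite /e'; field; rewrite gt_eqF.
rewrite ler_wpM2l ?(ltW Ms0) //; apply: le_trans h _.
by rewrite lerD2l.
Qed.

End PowerModulus.

(** * Continuous functional calculus *)

Section FunctionalCalculus.
Context {R : realType} {H : hilbertType R}.
Context (H_neq0 : exists x : H, x != 0).
Implicit Types (A B F G : H -> H) (x y : H) (f g h : R -> R).

Lemma eq_of_small x y (C : R) : 0 <= C ->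
  (forall e : R, 0 < e -> nrm (x - y) <= C * e) -> x = y.
Proof.
move=> C0 xy; apply/eqP; rewrite -subr_eq0 -nrm_eq0 eq_le nrm_ge0 andbT.
by apply: (le_epsM C0) => e e0; rewrite add0r xy.
Qed.

Definition poly_near f A (e : R) (p : {poly R}) : Prop :=
  forall t : R, spectrum A t%:C -> `|p.[t] - f t| <= e.

(* [B] is the value at [A] of the extension to uniform limits of the polynomial
   calculus; unlike in the definition of [cfc], this makes sense only when [f]
   is such a limit. *)
Definition cfc_limit f A B : Prop :=
  bounded_operator B /\
  forall e : R, 0 < e -> exists2 p, poly_near f A e p &
    forall x, nrm (poly_op p A x - B x) <= e * nrm x.

Section FixedOperator.
Context {A : H -> H} (bA : bounded_operator A) (sA : selfadjoint A).

Lemma nrm_poly_op_le (p : {poly R}) (c : R) x :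
  (forall t : R, spectrum A t%:C -> `|p.[t]| <= c) ->
  nrm (poly_op p A x) <= c * nrm x.
Proof.
move=> pc; apply: le_trans (opnormP x (bounded_poly_op p bA)) _.
by rewrite ler_wpM2r ?nrm_ge0 // opnorm_poly_le.
Qed.

Lemma nrm_poly_op_dist (p q : {poly R}) f (d e : R) x :
  poly_near f A d p -> poly_near f A e q ->
  nrm (poly_op p A x - poly_op q A x) <= (d + e) * nrm x.
Proof.
move=> pf qf; rewrite -poly_opB; apply: nrm_poly_op_le => t At.
rewrite hornerD hornerN; apply: le_trans (ler_distD (f t) _ _) _.
by rewrite lerD ?pf // distrC qf.
Qed.

(** By [opnorm_poly_le], polynomials uniformly close on the spectrum give operators close in norm,
    so [p n] evaluated at [A] converges at each vector, at a rate proportional to its norm. *)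
Lemma cfc_limit_exists f :
  (forall e : R, 0 < e -> exists p, poly_near f A e p) -> exists B, cfc_limit f A B.
Proof.
move=> fapp; have i0 n : 0 < n.+1%:R^-1 :> R by rewrite invr_gt0.
have /choice[p pP] n : exists p, poly_near f A n.+1%:R^-1 p by exact: fapp.
have /choice[B BP] : forall x, exists l, forall e : R, 0 < e ->
    exists N, forall n, (N <= n)%N -> nrm (poly_op (p n) A x - l) <= e.
  move=> x; apply: nrm_complete => e e0.
  have x0 := nrm_ge0 x; have x1 : 0 < 2 * nrm x + 1 by lra.
  have [|N NP] := @invS_small R (e / (2 * nrm x + 1)); first by rewrite divr_gt0.
  exists N => m n Nm Nn; apply: le_trans (nrm_poly_op_dist x (pP m) (pP n)) _.
  apply: le_trans (ler_wpM2r x0 (lerD (NP _ Nm) (NP _ Nn))) _.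
  have -> : (e / (2 * nrm x + 1) + e / (2 * nrm x + 1)) * nrm x
    = e * (2 * nrm x / (2 * nrm x + 1)) by field; rewrite gt_eqF.
  by rewrite ger_pMr // ler_pdivrMr // mul1r lerDl.
have pB n x : nrm (poly_op (p n) A x - B x) <= n.+1%:R^-1 * nrm x.
  have x0 := nrm_ge0 x; apply: (@le_epsM _ _ _ (nrm x + 1)); first by lra.
  move=> e e0; have [N1 H1] := BP x e e0; have [N2 H2] := invS_small e0.
  pose N := maxn N1 N2; apply: le_trans (nrm_distD (poly_op (p N) A x) _ _) _.
  have h1 := nrm_poly_op_dist x (pP n) (pP N).
  have h2 := H1 N (leq_maxl _ _).
  have h3 := ler_wpM2r x0 (H2 N (leq_maxr _ _)).
  move: h1 h2 h3; move: (N.+1%:R^-1 : R) (n.+1%:R^-1 : R) => a b; lra.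
exists B; split; last first.
  move=> e e0; have [N /(_ N (leqnn N)) NP] := invS_small e0; exists (p N).
    by move=> t At; apply: le_trans (pP N t At) NP.
  by move=> x; apply: le_trans (pB N x) _; rewrite ler_wpM2r ?nrm_ge0.
apply: (@bounded_operatorI _ _ _ (opnorm (poly_op (p 0) A) + 1)).
  move=> a x y; apply: (@eq_of_small _ _
    (nrm (a *: x + y) + (cabs a * nrm x + nrm y))) => [|e e0].
    by rewrite !addr_ge0 ?mulr_ge0 ?cabs_ge0 ?nrm_ge0.
  have [N /(_ N (leqnn N)) NP] := invS_small e0.
  have pNB z : nrm (poly_op (p N) A z - B z) <= e * nrm z.
    by apply: le_trans (pB N z) _; rewrite ler_wpM2r ?nrm_ge0.
  have -> : B (a *: x + y) - (a *: B x + B y) =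
      - (poly_op (p N) A (a *: x + y) - B (a *: x + y)) +
      (a *: (poly_op (p N) A x - B x) + (poly_op (p N) A y - B y)).
    rewrite (bounded_poly_op (p N) bA).1 scalerBr opprB.
    by rewrite [X in _ = _ + X]addrACA -opprD subrKA.
  apply: le_trans (nrmD _ _) _; rewrite nrmN [leRHS]mulrC mulrDr lerD //.
  apply: le_trans (nrmD _ _) _; rewrite mulrDr lerD // nrmZ mulrCA.
  by rewrite ler_wpM2l ?cabs_ge0.
move=> x; have -> : B x = poly_op (p 0) A x - (poly_op (p 0) A x - B x).
  by rewrite opprB addrC subrK.
apply: le_trans (nrmB _ _) _; rewrite mulrDl lerD ?opnormP //.
  exact: bounded_poly_op.
by apply: le_trans (pB 0%N x) _; rewrite invr1.
Qed.

Lemma cfc_limit_dist f B (d : R) p x : cfc_limit f A B -> poly_near f A d p ->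
  nrm (poly_op p A x - B x) <= d * nrm x.
Proof.
move=> [bB Bf] pf; have x0 := nrm_ge0 x.
apply: (@le_epsM _ _ _ (2 * nrm x)) => [|e e0]; first by rewrite mulr_ge0.
have [q qf qB] := Bf e e0.
apply: le_trans (nrm_distD (poly_op q A x) _ _) _.
by have := nrm_poly_op_dist x pf qf; have := qB x; lra.
Qed.

Lemma cfc_limit_unique f B F : cfc_limit f A B -> cfc_limit f A F -> B = F.
Proof.
move=> [_ Bf] Ff; apply/funext => x.
apply: (@eq_of_small _ _ (2 * nrm x)) => [|e e0]; first by rewrite mulr_ge0 ?nrm_ge0.
have [p pf pB] := Bf e e0.
apply: le_trans (nrm_distD (poly_op p A x) _ _) _; rewrite nrm_distC.
by have := pB x; have := cfc_limit_dist x Ff pf; lra.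
Qed.

(** The limit [B] meets the condition under [get]. Conversely, since approximating polynomials
    exist, whatever [get] returns is itself a limit, and limits are unique. *)
Lemma cfc_limitE f B : cfc_limit f A B -> cfc f A = B.
Proof.
move=> Bf; have [bB Bapp] := Bf.
set P := fun B' => bounded_operator B' /\ forall e : R, 0 < e -> exists2 d : R, 0 < d &
  forall p : {poly R}, poly_near f A d p -> opnorm (poly_op p A \- B') <= e.
have [bC CP] : P (cfc f A).
  apply: (@getPex _ P); exists B; split=> // e e0; exists e => // p pf.
  by apply: opnorm_le => [|x]; [exact: ltW | exact: (cfc_limit_dist x Bf pf)].
apply: (cfc_limit_unique (f := f)) => //; split=> // e e0.
(* The polynomial must be within [d] of [f] for [dP] to apply and within [e] for [cfc_limit]. *)
have [d d0 dP] := CP e e0; have m0 : 0 < Num.min d e by rewrite lt_min d0.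
have [p pf _] := Bapp _ m0; exists p.
  by move=> t At; apply: le_trans (pf t At) _; rewrite ge_min lexx orbT.
move=> x; apply: le_trans (opnormP x (bounded_sub (bounded_poly_op p bA) bC)) _.
rewrite ler_wpM2r ?nrm_ge0 //; apply: dP => t At.
by apply: le_trans (pf t At) _; rewrite ge_min lexx.
Qed.

Lemma cfc_limit_norm f F (c : R) x : cfc_limit f A F ->
  (forall t : R, spectrum A t%:C -> `|f t| <= c) -> nrm (F x) <= c * nrm x.
Proof.
move=> [_ Ff] fc; have x0 := nrm_ge0 x.
apply: (@le_epsM _ _ _ (2 * nrm x)) => [|e e0]; first by rewrite mulr_ge0.
have [p pf pF] := Ff e e0.
have -> : F x = poly_op p A x - (poly_op p A x - F x).
  by rewrite opprB addrC subrK.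
apply: le_trans (nrmB _ _) _.
have : nrm (poly_op p A x) <= (c + e) * nrm x.
  apply: nrm_poly_op_le => t At; rewrite -[p.[t]](subrK (f t)) addrC.
  by apply: le_trans (ler_normD _ _) _; rewrite lerD ?fc ?pf.
by have := pF x; lra.
Qed.

Lemma cfc_limit_selfadjoint f F : cfc_limit f A F -> selfadjoint F.
Proof.
move=> [_ Ff] x y; apply/eqP; rewrite -subr_eq0 -cabs_eq0 eq_le cabs_ge0 andbT.
have x0 := nrm_ge0 x; have y0 := nrm_ge0 y.
apply: (@le_epsM _ _ _ (2 * (nrm x * nrm y))) => [|e e0]; first by rewrite !mulr_ge0.
have [p pf pF] := Ff e e0.
have -> : inner (F x) y - inner x (F y) =
    inner x (poly_op p A y - F y) - inner (poly_op p A x - F x) y.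
  rewrite innerBl innerBr (selfadjoint_poly_op p sA).
  by rewrite opprB [RHS]addrC subrKA.
apply: le_trans (cabsD _ _) _; rewrite cabsN.
have h1 := le_trans (cauchy_schwarz x (poly_op p A y - F y)) (ler_wpM2l x0 (pF y)).
have h2 := le_trans (cauchy_schwarz (poly_op p A x - F x) y) (ler_wpM2r y0 (pF x)).
by lra.
Qed.

Lemma cfc_limit_id f : (forall t : R, spectrum A t%:C -> f t = t) -> cfc_limit f A A.
Proof.
move=> ft; split=> // e e0; exists 'X => [t At|x].
  by rewrite hornerX ft // subrr normr0 ltW.
by rewrite poly_opX // subrr nrm0 mulr_ge0 ?nrm_ge0 // ltW.
Qed.

Lemma cfc_limit_comp f g h F G (c : R) : cfc_limit f A F -> cfc_limit g A G ->
  (forall t : R, spectrum A t%:C -> [/\ `|f t| <= c, `|g t| <= c & h t = f t * g t]) ->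
  cfc_limit h A (F \o G).
Proof.
move=> Ff Gg fgh; have [bF Fapp] := Ff; have [bG Gapp] := Gg.
have [t0 At0] := spectrum_selfadjoint_nonempty H_neq0 bA sA.
have c0 : 0 <= c by have [+ _ _] := fgh _ At0; exact: le_trans.
have nG := opnorm_ge0 bG.
split; first exact: bounded_comp.
(* Both errors are at most [d * K]: [(c + d) * d + d * c] on the spectrum and
   [d * (c + d + opnorm G)] for the operators, using [d <= 1]. *)
move=> e e0; pose K := 2 * c + 1 + opnorm G.
have K0 : 0 < K by rewrite /K; lra.
pose d := Num.min 1 (e / K); have d0 : 0 < d by rewrite lt_min ltr01 divr_gt0.
have d1 : d <= 1 by rewrite /d ge_min lexx.
have dK : d * K <= e by rewrite -ler_pdivlMr // /d ge_min lexx orbT.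
have [p pf pF] := Fapp d d0; have [q qg qG] := Gapp d d0.
have pc t : spectrum A t%:C -> `|p.[t]| <= c + d.
  move=> At; have [fc _ _] := fgh _ At; rewrite -[p.[t]](subrK (f t)) addrC.
  by apply: le_trans (ler_normD _ _) _; rewrite lerD // pf.
exists (p * q) => [t At|x].
  have [fc gc ->] := fgh _ At; rewrite hornerM.
  have -> : p.[t] * q.[t] - f t * g t = p.[t] * (q.[t] - g t) + (p.[t] - f t) * g t.
    by ring.
  apply: le_trans (ler_normD _ _) _; rewrite !normrM.
  apply: le_trans (_ : (c + d) * d + d * c <= _).
    by rewrite lerD // ler_pM // ?pc ?qg ?pf.
  apply: le_trans dK; rewrite /K; nra.
rewrite poly_opM //=; apply: le_trans (nrm_distD (poly_op p A (G x)) _ _) _.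
rewrite -(linB (bounded_poly_op p bA).1).
have x0 := nrm_ge0 x.
have h1 := nrm_poly_op_le (poly_op q A x - G x) pc.
have cd0 : 0 <= c + d by rewrite addr_ge0 // ltW.
have h2 := le_trans h1 (ler_wpM2l cd0 (qG x)).
have h3 := le_trans (pF (G x)) (ler_wpM2l (ltW d0) (opnormP x bG)).
apply: le_trans (lerD h2 h3) _.
have -> : (c + d) * (d * nrm x) + d * (opnorm G * nrm x) =
  (d * (c + d + opnorm G)) * nrm x by ring.
rewrite ler_wpM2r //; apply: le_trans dK.
by rewrite ler_wpM2l ?(ltW d0) // /K; lra.
Qed.

End FixedOperator.

(** * Fractional powers of a positive operator *)

Section PositivePowers.
Context {A : H -> H} (pA : positive_op A).
Implicit Types (s r : R).

Let bA : bounded_operator A. Proof. by case: pA. Qed.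
Let sA : selfadjoint A. Proof. by case: pA. Qed.

Lemma spectrum_positive_itv (t : R) : spectrum A t%:C -> 0 <= t <= opnorm A.
Proof.
move=> At; rewrite (spectrum_positive pA At) /=.
by have := spectrum_le bA At; rewrite cabs_real; apply: le_trans (ler_norm _).
Qed.

Lemma spectrum_powR_le s (t : R) : 0 <= s -> spectrum A t%:C ->
  `|t `^ s| <= opnorm A `^ s.
Proof.
move=> s0 At; have /andP[t0 tA] := spectrum_positive_itv At.
by rewrite ger0_norm ?powR_ge0 // ge0_ler_powR ?nnegrE // (le_trans t0).
Qed.

Lemma op_power_limit s : 0 <= s <= 1 ->
  cfc_limit (fun t => t `^ s) A (op_power A s).
Proof.
move=> s01; have [|B BP] := cfc_limit_exists bA sA (f := fun t => t `^ s).
  (* Adding 1 keeps the interval of approximation nondegenerate when [A] is zero. *)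
  move=> e e0; have A1 : 0 < opnorm A + 1 by rewrite ltr_wpDl ?opnorm_ge0.
  have [p pP] := powR_poly_approx s01 A1 e0; exists p => t At; apply: pP.
  have /andP[-> tA] := spectrum_positive_itv At.
  by apply: le_trans tA _; rewrite lerDl.
by rewrite /op_power (cfc_limitE bA sA BP).
Qed.

Lemma op_power1 : op_power A 1 = A.
Proof.
apply: (cfc_limitE bA sA); apply: cfc_limit_id => // t At.
by rewrite powRr1 //; have /andP[] := spectrum_positive_itv At.
Qed.

Lemma op_powerD s r : 0 <= s -> 0 <= r -> s + r <= 1 ->
  op_power A (s + r) = op_power A s \o op_power A r.
Proof.
move=> s0 r0 sr1; have s01 : 0 <= s <= 1 by lra.
have r01 : 0 <= r <= 1 by lra.
apply: (cfc_limitE bA sA).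
apply: (cfc_limit_comp bA sA (op_power_limit s01) (op_power_limit r01)
  (c := opnorm A `^ s + opnorm A `^ r)) => t At.
split.
- by apply: le_trans (spectrum_powR_le s0 At) _; rewrite lerDl powR_ge0.
- by apply: le_trans (spectrum_powR_le r0 At) _; rewrite lerDr powR_ge0.
(* When the exponents sum to 0, [powRD] would need a nonzero base; then both vanish and all powers
   equal 1. *)
have [sr0|sr0] := eqVneq (s + r) 0; last by rewrite powRD // (negbTE sr0).
have -> : s = 0 by lra.
have -> : r = 0 by lra.
by rewrite addr0 !powRr0 mulr1.
Qed.

Lemma bounded_op_power s : 0 <= s <= 1 -> bounded_operator (op_power A s).
Proof. by case/op_power_limit. Qed.

Lemma op_power_selfadjoint s : 0 <= s <= 1 -> selfadjoint (op_power A s).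
Proof. by move/op_power_limit/(cfc_limit_selfadjoint sA). Qed.

Lemma opnorm_op_power s : 0 <= s <= 1 -> opnorm (op_power A s) <= opnorm A `^ s.
Proof.
move=> s01; apply: opnorm_le => [|x]; first exact: powR_ge0.
apply: (cfc_limit_norm bA sA x (op_power_limit s01)) => t.
by apply: spectrum_powR_le; case/andP: s01.
Qed.

Lemma op_power_positive s : 0 <= s <= 1 -> positive_op (op_power A s).
Proof.
move=> s01; split; [exact: bounded_op_power | exact: op_power_selfadjoint|] => x.
have h01 : 0 <= s / 2 <= 1 by lra.
have -> : op_power A s = op_power A (s / 2) \o op_power A (s / 2).
  by rewrite -op_powerD -?splitr //; lra.
rewrite /rip /= (op_power_selfadjoint h01) inner_xx /=.
by rewrite exprn_ge0 ?nrm_ge0.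
Qed.

End PositivePowers.

End FunctionalCalculus.

(** * Polar decomposition *)

Section PolarDecomposition.
Context {R : realType} {H : hilbertType R}.
Implicit Types (T U : H -> H) (x y : H).

Lemma closed_subspace_kernel U : bounded_operator U ->
  closed_subspace (fun x => U x = 0).
Proof.
move=> bU; split=> [|a x y Ux Uy|x xcl]; first exact: (lin0 bU.1).
  by rewrite bU.1 Ux Uy scaler0 addr0.
apply: (eq_of_small (opnorm_ge0 bU)) => e e0; have [y Uy xy] := xcl e e0.
rewrite -Uy -(linB bU.1); apply: le_trans (opnormP _ bU) _.
by rewrite ler_wpM2l // opnorm_ge0.
Qed.

(** Removing from [x] its projection onto the kernel leaves [U x] unchanged, and [U] is isometric on
    what remains. *)
Lemma partial_isometry_contraction U x : partial_isometry U -> nrm (U x) <= nrm x.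
Proof.
move=> [bU iU]; have [k Uk ko] := orthogonal_projection x (closed_subspace_kernel bU).
have -> : U x = U (x - k) by rewrite (linB bU.1) Uk subr0.
have -> : nrm (U (x - k)) = nrm (x - k) by rewrite /nrm iU.
rewrite -[x in leRHS](subrK k).
rewrite -ler_sqr ?nnegrE ?nrm_ge0 // (nrm_sqrD (x - k)) /rip ko //= mulr0 addr0.
by rewrite lerDl exprn_ge0 ?nrm_ge0.
Qed.

Section Modulus.
Context (H_neq0 : exists x : H, x != 0) {T : H -> H} (bT : bounded_operator T).
Let P : H -> H := op_abs T.

Lemma adjoint_comp_positive : positive_op (adjoint T \o T).
Proof.
have [bS TS] := adjoint_spec bT.
have ST y z : inner (adjoint T y) z = inner y (T z).
  by rewrite innerC -TS -innerC.
split; first exact: bounded_comp.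
- by move=> x y /=; rewrite ST TS.
- by move=> x; rewrite /rip /= ST inner_xx /= exprn_ge0 ?nrm_ge0.
Qed.

Let half01 : 0 <= (2^-1 : R) <= 1. Proof. by lra. Qed.

Lemma op_abs_positive : positive_op P.
Proof. exact: (op_power_positive H_neq0 adjoint_comp_positive half01). Qed.

Lemma op_abs_sqr x : P (P x) = adjoint T (T x).
Proof.
have h2 : (2^-1 : R) + 2^-1 = 1 by field.
have := op_powerD H_neq0 adjoint_comp_positive (s := 2^-1) (r := 2^-1).
rewrite h2 op_power1 //; last exact: adjoint_comp_positive.
by move=> E; rewrite -[RHS]/((adjoint T \o T) x) E //; lra.
Qed.

(** This is what makes [P y |-> T y] a well-defined isometry. *)
Lemma nrm_op_abs x : nrm (P x) = nrm (T x).
Proof.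
have [_ sP _] := op_abs_positive; have [_ TS] := adjoint_spec bT.
apply/eqP; rewrite -(eqrXn2 (n := 2)) ?nrm_ge0 //; apply/eqP/complexI.
by rewrite -!inner_xx sP op_abs_sqr TS.
Qed.

Lemma op_abs_eq0 x : P x = 0 <-> T x = 0.
Proof.
by split=> /(congr1 nrm); rewrite nrm0 (nrm_op_abs, =^~ nrm_op_abs) => /nrm0_eq0.
Qed.

Lemma opnorm_op_abs : opnorm P <= opnorm T.
Proof.
by apply: opnorm_le => [|x]; [exact: opnorm_ge0 | rewrite nrm_op_abs opnormP].
Qed.

(* [w] is the value at [x] of the partial isometry extending [P y |-> T y];
   [b] is the component of [x] orthogonal to the range of [P]. *)
Definition polar_graph (b x w : H) : Prop :=
  (forall y, inner b (P y) = 0) /\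
  forall e : R, 0 < e ->
    exists2 y, nrm (x - b - P y) <= e & nrm (w - T y) <= e.

(** Project [x] onto the closure of the range of [P] and approximate the projection by vectors
    [P (u n)]; then [T (u n)] is Cauchy by [nrm_op_abs], and [w] is its limit. *)
Lemma polar_graph_total x : exists w, exists b, polar_graph b x w.
Proof.
have [bP _ _] := op_abs_positive.
have clK : closed_subspace (fun a => forall e : R, 0 < e ->
    exists y, nrm (a - P y) <= e).
  split=> [e e0|a u v uK vK e e0|u ucl e e0].
  - by exists 0; rewrite (lin0 bP.1) subr0 nrm0 ltW.
  - have ca := cabs_ge0 a; have c0 : 0 < cabs a + 1 by rewrite ltr_wpDl.
    pose d := e / (cabs a + 1); have d0 : 0 < d by rewrite divr_gt0.
    have [y yu] := uK d d0; have [z zv] := vK d d0; exists (a *: y + z).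
    rewrite bP.1 opprD addrACA -scalerBr; apply: le_trans (nrmD _ _) _.
    have -> : e = cabs a * d + d by rewrite /d; field; rewrite gt_eqF.
    by rewrite nrmZ lerD // ler_wpM2l.
  - have e2 : 0 < e / 2 by rewrite divr_gt0.
    have [v vK uv] := ucl _ e2; have [y vy] := vK _ e2; exists y.
    by apply: le_trans (nrm_distD v _ _) _; rewrite (splitr e) lerD.
have [k kK ko] := orthogonal_projection x clK.
have /choice[u uP] : forall n, exists y, nrm (k - P y) <= n.+1%:R^-1.
  by move=> n; apply: kK; rewrite invr_gt0.
have [|w uw] := @nrm_complete _ _ (T \o u).
  move=> e e0; have [|N NP] := @invS_small R (e / 2); first by rewrite divr_gt0.
  exists N => m n Nm Nn /=; rewrite -(linB bT.1) -nrm_op_abs (linB bP.1).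
  apply: le_trans (nrm_distD k _ _) _; rewrite (splitr e) lerD //.
    by rewrite nrm_distC; apply: le_trans (uP m) (NP _ Nm).
  exact: le_trans (uP n) (NP _ Nn).
exists w, (x - k); split=> [y|e e0].
  by apply: ko => e e0; exists y; rewrite subrr nrm0 ltW.
have [N1 H1] := uw e e0; have [N2 H2] := invS_small e0; pose N := maxn N1 N2.
exists (u N); last by rewrite nrm_distC; exact: H1 (leq_maxl _ _).
rewrite subKr; exact: le_trans (uP N) (H2 N (leq_maxr _ _)).
Qed.

Lemma polar_graph_linear (a : R[i]) b x w b' x' w' :
  polar_graph b x w -> polar_graph b' x' w' ->
  polar_graph (a *: b + b') (a *: x + x') (a *: w + w').
Proof.
have [bP _ _] := op_abs_positive.
move=> [ob xw] [ob' xw']; split=> [y|e e0].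
  by rewrite innerDl innerZl ob ob' mulr0 addr0.
have ca := cabs_ge0 a; have c0 : 0 < cabs a + 1 by rewrite ltr_wpDl.
pose d := e / (cabs a + 1); have d0 : 0 < d by rewrite divr_gt0.
have [y xy wy] := xw d d0; have [y' xy' wy'] := xw' d d0.
have eE : e = cabs a * d + d by rewrite /d; field; rewrite gt_eqF.
exists (a *: y + y').
  rewrite bP.1 opprD addrACA -scalerBr opprD addrACA -scalerBr.
  by apply: le_trans (nrmD _ _) _; rewrite eE nrmZ lerD // ler_wpM2l.
rewrite bT.1 opprD addrACA -scalerBr.
by apply: le_trans (nrmD _ _) _; rewrite eE nrmZ lerD // ler_wpM2l.
Qed.

Lemma polar_graph_nrm b x w : polar_graph b x w -> nrm w = nrm (x - b).
Proof.
move=> [_ xw]; apply/eqP; rewrite eq_le; apply/andP; split.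
  apply: (@le_epsM _ _ _ 2) => // e e0; have [y xy wy] := xw e e0.
  have := nrm_distD (T y) w 0; have := nrm_distD (x - b) (P y) 0.
  by rewrite !subr0 nrm_op_abs (nrm_distC (P y)); lra.
apply: (@le_epsM _ _ _ 2) => // e e0; have [y xy wy] := xw e e0.
have := nrm_distD w (T y) 0; have := nrm_distD (P y) (x - b) 0.
by rewrite !subr0 nrm_op_abs (nrm_distC (T y)); lra.
Qed.

Lemma polar_graph_orth b x w : polar_graph b x w -> inner (x - b) b = 0.
Proof.
move=> [ob xw]; apply/eqP; rewrite -cabs_eq0 eq_le cabs_ge0 andbT.
apply: (@le_epsM _ _ _ (nrm b)) => [|e e0]; first exact: nrm_ge0.
have [y xy _] := xw e e0; rewrite add0r.
have -> : inner (x - b) b = inner (x - b - P y) b.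
  by rewrite [RHS]innerBl (innerC b (P y)) ob conjc0 subr0.
by apply: le_trans (cauchy_schwarz _ _) _; rewrite mulrC ler_wpM2l ?nrm_ge0.
Qed.

Lemma polar_graph_le b x w : polar_graph b x w -> nrm w <= nrm x.
Proof.
move=> xw; rewrite (polar_graph_nrm xw) -[x in leRHS](subrK b).
rewrite -ler_sqr ?nnegrE ?nrm_ge0 // (nrm_sqrD (x - b)) /rip (polar_graph_orth xw).
by rewrite /= mulr0 addr0 lerDl exprn_ge0 ?nrm_ge0.
Qed.

(** By linearity the difference of the two values lies over the vector 0, where [polar_graph_le]
    forces it to vanish. *)
Lemma polar_graph_unique b x w b' w' :
  polar_graph b x w -> polar_graph b' x w' -> w = w'.
Proof.
move=> xw xw'; have /polar_graph_le := polar_graph_linear (-1) xw xw'.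
rewrite !scaleN1r addNr nrm0 => h; have : nrm (- w + w') = 0.
  by apply/eqP; rewrite eq_le h nrm_ge0.
by move/nrm0_eq0; rewrite addrC => /eqP; rewrite subr_eq0 => /eqP.
Qed.

Lemma polar_part_exists : exists U,
  [/\ partial_isometry U, T = U \o P & forall x, U x = 0 <-> T x = 0].
Proof.
have [bP sP _] := op_abs_positive.
have /choice[U /choice[b UP]] := polar_graph_total.
have orthP c : (forall y, inner c (P y) = 0) -> T c = 0.
  move=> oc; apply/op_abs_eq0/nrm0_eq0/eqP; rewrite -sqrf_eq0; apply/eqP/complexI.
  by rewrite -inner_xx sP oc.
have kerU x : U x = 0 <-> T x = 0.
  split=> [Ux0|Tx0].
    have := polar_graph_nrm (UP x); rewrite Ux0 nrm0 => /esym/nrm0_eq0/eqP.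
    rewrite subr_eq0 => /eqP ->; exact: orthP (UP x).1.
  apply: (polar_graph_unique (b' := x) (UP x)); split=> [y|e e0].
    by rewrite -sP (op_abs_eq0 x).2 // inner0l.
  by exists 0; rewrite ?(lin0 bP.1) ?(lin0 bT.1) ?subrr ?subr0 nrm0 ltW.
have bU : bounded_operator U.
  apply: (@bounded_operatorI _ _ _ 1) => [a x y|x].
    exact: polar_graph_unique (UP _) (polar_graph_linear a (UP x) (UP y)).
  by rewrite mul1r; exact: polar_graph_le (UP x).
exists U; split=> //.
  (* The residual [b x] lies in the kernel of [U], so it is orthogonal to [x] by [xo] and to
     [x - b x] by construction, hence to itself. *)
  split=> // x xo; have b0 : b x = 0.
    have Ub : U (b x) = 0 by apply/kerU/orthP; exact: (UP x).1.
    have := polar_graph_orth (UP x); rewrite innerBl xo // sub0r inner_xx.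
    move/eqP; rewrite oppr_eq0 -(rmorph0 (real_complex R)) (inj_eq (@complexI R)).
    by rewrite sqrf_eq0 nrm_eq0 => /eqP.
  by rewrite !nrmE (polar_graph_nrm (UP x)) b0 subr0.
apply/funext => x /=; apply: (polar_graph_unique (b := 0) (x := P x)) (UP _).
split=> [y|e e0]; first by rewrite inner0l.
by exists x; rewrite ?subr0 subrr nrm0 ltW.
Qed.

Lemma polar_partP : partial_isometry (polar_part T) /\ T = polar_part T \o P.
Proof.
have [] : [/\ partial_isometry (polar_part T), T = polar_part T \o P &
    forall x, polar_part T x = 0 <-> T x = 0]; last by [].
exact: (@getPex _ (fun U => [/\ partial_isometry U, T = U \o P &
  forall x, U x = 0 <-> T x = 0]) polar_part_exists).
Qed.

(** The norm bound holds because the polar part is a contraction and the exponents [1 - lambda] and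
    [lambda] of [opnorm P] sum to 1. *)
Lemma aluthge_factorization (lambda : R) : 0 <= lambda <= 1 ->
  exists B C, [/\ bounded_operator B, bounded_operator C, T = B \o C,
    aluthge lambda T = C \o B & opnorm B * opnorm C <= opnorm T].
Proof.
move=> l01; have l01' : 0 <= 1 - lambda <= 1 by lra.
have pP := op_abs_positive; have [bP _ _] := pP.
have [iU TE] := polar_partP; have bU : bounded_operator (polar_part T) by case: iU.
have bC := bounded_op_power H_neq0 pP l01.
have bD := bounded_op_power H_neq0 pP l01'.
exists (polar_part T \o op_power P (1 - lambda)), (op_power P lambda); split=> //.
- exact: bounded_comp.
- rewrite [LHS]TE; apply/funext => x /=; congr (polar_part T _).
  have := op_powerD H_neq0 pP (s := 1 - lambda) (r := lambda).
  rewrite subrK op_power1 // => E.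
  by rewrite -[RHS]/((op_power P (1 - lambda) \o op_power P lambda) x) -E //; lra.
have U1 : opnorm (polar_part T) <= 1.
  by apply: opnorm_le => // x; rewrite mul1r partial_isometry_contraction.
have P0 := opnorm_ge0 bP.
have h1 : opnorm (polar_part T \o op_power P (1 - lambda)) <=
    opnorm P `^ (1 - lambda).
  apply: le_trans (opnorm_comp bU bD) _; rewrite -[leRHS]mul1r.
  by rewrite ler_pM ?opnorm_ge0 ?opnorm_op_power.
apply: le_trans opnorm_op_abs.
apply: le_trans (ler_pM _ _ h1 (opnorm_op_power H_neq0 pP l01)) _.
- by rewrite opnorm_ge0 //; exact: bounded_comp.
- by rewrite opnorm_ge0.
by rewrite -powRD ?subrK ?oner_eq0 // powRr1.
Qed.

End Modulus.

End PolarDecomposition.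

(** * Powers, spectral radius and the Aluthge transform *)

Section SpectralRadius.
Context {R : realType} {H : hilbertType R}.
Context (H_neq0 : exists x : H, x != 0).
Implicit Types (T : H -> H) (x y : H) (z w : R[i]).

Lemma opnorm_id : opnorm (@id H) = 1.
Proof.
apply/eqP; rewrite eq_le opnorm_le //=; last by move=> x; rewrite mul1r.
have [v v0] := H_neq0; have := opnormP v (@bounded_id R H).
by rewrite -[leLHS]mul1r ler_pM2r ?nrm_gt0.
Qed.

Lemma opnorm_iter_le T k : bounded_operator T -> opnorm (iter k T) <= opnorm T ^+ k.
Proof.
move=> bT; elim: k => [|k IH]; first by rewrite opnorm_id expr0.
apply: le_trans (opnorm_comp bT (bounded_iter k bT)) _.
by rewrite exprS ler_wpM2l ?opnorm_ge0.
Qed.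

Lemma opnorm_gt T (c : R) : bounded_operator T -> 0 <= c -> c < opnorm T ->
  exists x, c * nrm x < nrm (T x).
Proof.
move=> bT c0 cT; apply: contrapT => no; move: cT; apply/negP; rewrite -leNgt.
by apply: opnorm_le => // x; rewrite leNgt; apply/negP => h; apply: no; exists x.
Qed.

(** The supremum of the empty set is 0 by convention, so the bounds below can treat an empty
    spectrum as a separate case. *)
Lemma spectral_radius_empty T : ~ (exists z, spectrum T z) -> spectral_radius T = 0.
Proof.
move=> s0; rewrite /spectral_radius (_ : spectrum T = classical_sets.set0).
  by rewrite image_set0 sup0.
by apply/seteqP; split=> // z Tz; apply: s0; exists z.
Qed.

Lemma spectral_radius_le T (c : R) : 0 <= c ->
  (forall z, spectrum T z -> cabs z <= c) -> spectral_radius T <= c.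
Proof.
move=> c0 Tc; have [[z Tz]|/spectral_radius_empty -> //] :=
  pselect (exists z, spectrum T z).
by apply: ge_sup => [|_ [w Tw <-]]; [exists (cabs z), z | exact: Tc].
Qed.

Lemma spectral_radius_ge T z : bounded_operator T -> spectrum T z ->
  cabs z <= spectral_radius T.
Proof.
move=> bT Tz; apply: ub_le_sup; last by exists z.
by exists (opnorm T) => _ [w Tw <-]; exact: spectrum_le.
Qed.

Lemma spectral_radius_ge0 T : bounded_operator T -> 0 <= spectral_radius T.
Proof.
move=> bT; have [[z Tz]|/spectral_radius_empty -> //] :=
  pselect (exists z, spectrum T z).
exact: le_trans (cabs_ge0 z) (spectral_radius_ge bT Tz).
Qed.

Lemma cpoly_opXn T k x : bounded_operator T -> cpoly_op 'X^k T x = iter k T x.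
Proof.
move=> bT; elim: k => [|k IH]; first by rewrite expr0 cpoly_opC scale1r.
by rewrite exprSr cpoly_opMX // IH.
Qed.

(** The factor [z - T] divides [z^k - T^k], so an inverse of the latter yields one of the former. *)
Lemma spectrum_iter T z k : bounded_operator T -> spectrum T z ->
  spectrum (iter k T) (z ^+ k).
Proof.
move=> bT Tz [S [bS SP PS]]; apply: Tz.
pose p : {poly R[i]} := (z ^+ k)%:P - 'X^k.
have /factor_theorem[q pE] : root p z by rewrite rootE !hornerE subrr.
have pop x : cpoly_op p T x = z ^+ k *: x - iter k T x.
  by rewrite cpoly_opD cpoly_opC -scaleN1r cpoly_opZ cpoly_opXn // scaleN1r.
have lop x : cpoly_op (z%:P - 'X) T x = z *: x - T x.
  by rewrite cpoly_opD cpoly_opC -scaleN1r cpoly_opZ cpoly_opX // scaleN1r.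
have pE1 : p = - q * (z%:P - 'X) by rewrite pE mulNr -mulrN opprB.
have left_inv x : S (cpoly_op (- q) T (z *: x - T x)) = x.
  by rewrite -lop -cpoly_opM // -pE1 pop SP.
have right_inv x : z *: cpoly_op (- q) T (S x) - T (cpoly_op (- q) T (S x)) = x.
  by rewrite -lop -cpoly_opM // mulrC -pE1 pop PS.
exists (S \o cpoly_op (- q) T); split=> [|//|x] /=.
  exact: bounded_comp bS (bounded_cpoly _ bT).
(* A left and a right inverse of the same operator coincide. *)
suff -> : S (cpoly_op (- q) T x) = cpoly_op (- q) T (S x) by exact: right_inv.
by rewrite -[in LHS](right_inv x) left_inv.
Qed.

Lemma spectral_radius_pow_le T k : bounded_operator T ->
  spectral_radius T ^+ k.+1 <= opnorm (iter k.+1 T).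
Proof.
move=> bT; set N := opnorm (iter _ _).
have N0 : 0 <= N := opnorm_ge0 (bounded_iter _ bT).
have root_pow : (N `^ k.+1%:R^-1) ^+ k.+1 = N.
  by rewrite -powR_mulrn ?powR_ge0 // -powRrM mulVf // powRr1.
rewrite -[leRHS]root_pow lerXn2r ?nnegrE ?powR_ge0 ?spectral_radius_ge0 //.
apply: spectral_radius_le => [|z Tz]; first exact: powR_ge0.
rewrite -(@ler_pXn2r _ k.+1) ?nnegrE ?powR_ge0 ?cabs_ge0 // root_pow -cabsX.
by apply: spectrum_le; [exact: bounded_iter | exact: spectrum_iter].
Qed.

(* Splitting the sum into halves, [z ^+ 2 ^ m] may be chosen among the two square
   roots of [c]; by the parallelogram law one of them does not decrease the sum
   of squares. *)
Lemma large_unimodular_sum m (v : nat -> H) (c : R[i]) : cabs c = 1 ->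
  exists2 z, z ^+ (2 ^ m) = c &
    \sum_(j < 2 ^ m) nrm (v j) ^+ 2 <= nrm (\sum_(j < 2 ^ m) z ^+ j *: v j) ^+ 2.
Proof.
elim: m v c => [|m IH] v c c1.
  by exists c; rewrite ?expr1 // !big_ord1 expr0 scale1r.
pose s := sqrtc c; have s2 : s ^+ 2 = c by exact: sqr_sqrtc.
have s1 : cabs s = 1.
  have : cabs s ^+ 2 == 1 by rewrite -cabsX s2 c1.
  by rewrite sqrp_eq1 ?cabs_ge0 // => /eqP.
pose M := (2 ^ m)%N; have E2 : (2 ^ m.+1 = M + M)%N by rewrite expnS mul2n addnn.
suff [s' [s'2 s'1 large]] : exists s', [/\ s' ^+ 2 = c, cabs s' = 1 &
    \sum_(j < 2 ^ m.+1) nrm (v j) ^+ 2 <=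
    \sum_(j < M) nrm (v j + s' *: v (M + j)%N) ^+ 2].
  have [z zM zlarge] := IH (fun j => v j + s' *: v (M + j)%N) s' s'1.
  exists z; first by rewrite E2 exprD zM -expr2.
  apply: le_trans large _; apply: le_trans zlarge _.
  rewrite E2 big_split_ord /= -big_split /=.
  suff -> : \sum_(j < M) z ^+ j *: (v j + s' *: v (M + j)%N) =
    \sum_(i < M) (z ^+ i *: v i + z ^+ (M + i) *: v (M + i)%N) by [].
  apply: eq_bigr => j _.
  by rewrite scalerDr scalerA exprD zM (mulrC s').
have sum_eq : \sum_(j < M) nrm (v j + s *: v (M + j)%N) ^+ 2 +
    \sum_(j < M) nrm (v j + - s *: v (M + j)%N) ^+ 2 =
    2 * \sum_(j < 2 ^ m.+1) nrm (v j) ^+ 2.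
  rewrite E2 big_split_ord /= -!big_split /= mulr_sumr; apply: eq_bigr => j _.
  by rewrite scaleNr parallelogram nrmZ s1 mul1r.
have [h|h] := leP (\sum_(j < 2 ^ m.+1) nrm (v j) ^+ 2)
  (\sum_(j < M) nrm (v j + s *: v (M + j)%N) ^+ 2); first by exists s.
by exists (- s); rewrite sqrrN cabsN; split=> //; lra.
Qed.

Lemma approximate_eigenvector T (e : R) : bounded_operator T -> 0 < opnorm T ->
  (forall k, opnorm T ^+ k = opnorm (iter k T)) -> 0 < e ->
  exists z, cabs z = opnorm T /\ exists2 y, y != 0 & nrm (z *: y - T y) <= e * nrm y.
Proof.
move=> bT N0 Tpow e0; set N := opnorm T in N0 Tpow *.
have N1 : 0 < 16 * N ^+ 2 by rewrite mulr_gt0 // exprn_gt0.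
(* Of the factor 16, one 4 comes from [|v 0 - v n| <= 2 |x|] squared and one from
   [|y|^2 >= n |x|^2 / 4]. *)
have [|m /(_ m (leqnn m)) mP] := @invS_small R (e ^+ 2 / (16 * N ^+ 2)).
  by rewrite divr_gt0 // exprn_gt0.
pose n := (2 ^ m)%N; have nm : (m.+1 <= n)%N by exact: ltn_expl.
have n0 : 0 < n%:R :> R by rewrite ltr0n expn_gt0.
have nP : 16 * N ^+ 2 <= e ^+ 2 * n%:R.
  have : m.+1%:R^-1 * (16 * N ^+ 2) <= e ^+ 2 by rewrite -ler_pdivlMr.
  rewrite mulrC ler_pdivrMr // => /le_trans; apply.
  by rewrite ler_wpM2l ?exprn_ge0 ?(ltW e0) // ler_nat.
have Nn j : 0 < N ^+ j by rewrite exprn_gt0.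
(* Reaching half of the norm of [T^n] at the last step keeps every rescaled iterate [v j], [j <= n],
   between [|x| / 2] and [|x|]. *)
have [x xP] : exists x, N ^+ n / 2 * nrm x < nrm (iter n T x).
  apply: opnorm_gt; [exact: bounded_iter | by rewrite divr_ge0 // ltW|].
  by rewrite -Tpow ltr_pdivrMr // ltr_pMr // ltr1n.
have x0 : 0 < nrm x.
  rewrite lt_def nrm_ge0 andbT; apply: contraTneq xP => x0.
  by rewrite (nrm0_eq0 x0) (lin0 (bounded_iter _ bT).1) nrm0 mulr0 ltxx.
pose v j := (N ^- j)%:C *: iter j T x.
have vS j : T (v j) = N%:C *: v j.+1.
  rewrite /v (linZ bT.1) scalerA -rmorphM /=; congr (_%:C *: _).
  by rewrite exprS invfM mulrA divff ?gt_eqF // mul1r.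
have v_le j : nrm (v j) <= nrm x.
  rewrite nrmZr ger0_norm ?invr_ge0 ?(ltW (Nn j)) // mulrC ler_pdivrMr //.
  by rewrite mulrC Tpow opnormP //; exact: bounded_iter.
have v_ge j : (j <= n)%N -> nrm x / 2 <= nrm (v j).
  move=> jn; rewrite nrmZr ger0_norm ?invr_ge0 ?(ltW (Nn j)) // [leRHS]mulrC.
  rewrite ler_pdivlMr // -(ler_pM2l (Nn (n - j)%N)).
  have -> : N ^+ (n - j) * (nrm x / 2 * N ^+ j) = N ^+ n / 2 * nrm x.
    by rewrite -[in RHS](subnK jn) exprD; ring.
  have := opnormP (iter j T x) (bounded_iter (n - j) bT).
  by rewrite -Tpow -iterD subnK //; exact: le_trans (ltW xP).
(* Taking [c = 1] gives [w ^+ n = 1], so shifting the sum [y] by one index changes it only by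
   [v n - v 0]. *)
have [w wn wP] := large_unimodular_sum m v (@cabs1 R).
have w1 : cabs w = 1.
  have : cabs w ^+ n == 1 by rewrite -cabsX wn cabs1.
  by rewrite pexpr_eq1 ?expn_gt0 ?cabs_ge0 // => /eqP.
have w0 : w != 0 by rewrite -cabs_eq0 w1 oner_eq0.
pose y := \sum_(j < n) w ^+ j *: v j; rewrite -/n -/y in wP.
have y_ge : n%:R * nrm x ^+ 2 <= 4 * nrm y ^+ 2.
  suff : n%:R * (nrm x / 2) ^+ 2 <= nrm y ^+ 2.
    have -> : (nrm x / 2) ^+ 2 = nrm x ^+ 2 / 4 by field.
    by lra.
  apply: le_trans wP; rewrite mulr_natl -[n in leLHS]card_ord -sumr_const.
  apply: ler_sum => j _; rewrite lerXn2r ?nnegrE ?divr_ge0 ?nrm_ge0 //.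
  by apply: v_ge; exact: ltnW.
have wTy : w *: T y = N%:C *: (y + (v n - v 0)).
  have -> : y + (v n - v 0) = \sum_(j < n) w ^+ j.+1 *: v j.+1.
    have E : v 0 + \sum_(j < n) w ^+ j.+1 *: v j.+1 = y + v n.
      transitivity (\sum_(j < n.+1) w ^+ j *: v j).
        by rewrite big_ord_recl /= expr0 scale1r.
      by rewrite big_ord_recr /= wn scale1r.
    by rewrite addrA -E addrC addKr.
  rewrite (lin_sum bT.1) !scaler_sumr; apply: eq_bigr => j _.
  by rewrite (linZ bT.1) vS scalerA scalerA scalerA -exprS mulrC.
exists (N%:C * w^-1); split.
  rewrite cabsM cabs_real ger0_norm ?(ltW N0) // -[RHS]mulr1; congr (_ * _).
  by have := cabsM w w^-1; rewrite divff // cabs1 w1 mul1r.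
exists y.
  rewrite -nrm_eq0; apply: contraTneq y_ge => ->.
  by rewrite expr0n mulr0 -ltNge mulr_gt0 // exprn_gt0.
have -> : nrm ((N%:C * w^-1) *: y - T y) = N * nrm (v 0 - v n).
  rewrite -[LHS]mul1r -w1 -nrmZ scalerBr scalerA mulrCA divff // mulr1 wTy.
  rewrite scalerDr opprD addrA subrr sub0r -scalerN opprB nrmZr.
  by rewrite ger0_norm // ltW.
have v2 : nrm (v 0 - v n) <= 2 * nrm x.
  by apply: le_trans (nrmB _ _) _; have := v_le 0; have := v_le n; lra.
rewrite -ler_sqr ?nnegrE ?mulr_ge0 ?nrm_ge0 ?(ltW e0) ?(ltW N0) //.
apply: le_trans (_ : (N * (2 * nrm x)) ^+ 2 <= _).
  by rewrite lerXn2r ?nnegrE ?mulr_ge0 ?nrm_ge0 ?(ltW N0) // ler_wpM2l // ltW.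
rewrite !exprMn -(ler_pM2l (ltr0n _ 4%N)) /=.
have h1 := ler_wpM2r (exprn_ge0 2 (nrm_ge0 x)) nP.
have h2 := ler_wpM2l (exprn_ge0 2 (ltW e0)) y_ge.
by lra.
Qed.

(** Bolzano-Weierstrass, obtained from compactness of a square in [R * R] through real and imaginary
    parts. *)
Lemma bounded_sequence_cluster (u : nat -> R[i]) (M : R) :
  (forall n, cabs (u n) <= M) ->
  exists z, forall (e : R) N, 0 < e -> exists2 n, (N <= n)%N & cabs (u n - z) <= e.
Proof.
move=> uM; pose f n : R * R := (complex.Re (u n), complex.Im (u n)).
have Im_le z : `|complex.Im z| <= cabs z.
  rewrite -ler_sqr ?nnegrE ?cabs_ge0 // cabs_sqrE.
  by rewrite real_normK ?num_real // lerDr sqr_ge0.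
have cK : compact (`[- M, M] `*` `[- M, M] : set (R * R))%classic.
  by apply: compact_setX; exact: segment_compact.
have fK : (f @ \oo)%classic (`[- M, M] `*` `[- M, M])%classic.
  exists 0%N => // n _; split; rewrite /= in_itv /= -ler_norml.
    exact: le_trans (Re_le_cabs _) (uM n).
  exact: le_trans (Im_le _) (uM n).
have [p [_ pcl]] := cK _ _ fK.
exists (p.1 +i* p.2) => e N e0.
have tailN : (f @ \oo)%classic (f @` [set n | (N <= n)%N])%classic.
  by exists N => // n /= Nn; exists n.
have e2 : 0 < e / 2 by rewrite divr_gt0.
have [_ [[n /= Nn <-] [B1 B2]]] := pcl _ _ tailN (nbhsx_ballx p (PosNum e2)%:num (gt0 _)).
exists n => //; move: B1 B2; rewrite /ball /= => B1 B2.
have tri z : cabs z <= `|complex.Re z| + `|complex.Im z|.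
  rewrite -ler_sqr ?nnegrE ?cabs_ge0 ?addr_ge0 // cabs_sqrE sqrrD.
  by rewrite !real_normK ?num_real // lerD2r lerDl mulrn_wge0 // mulr_ge0.
apply: le_trans (tri _) _; rewrite (splitr e) cReD cReN cImD cImN /=.
by rewrite lerD // distrC ltW.
Qed.

Lemma pow_norm_spectrum T : bounded_operator T -> 0 < opnorm T ->
  (forall k, opnorm T ^+ k = opnorm (iter k T)) ->
  exists2 z, spectrum T z & cabs z = opnorm T.
Proof.
move=> bT N0 Tpow.
have /choice[u uP] : forall n, exists z, cabs z = opnorm T /\
    exists2 y, y != 0 & nrm (z *: y - T y) <= n.+1%:R^-1 * nrm y.
  by move=> n; apply: approximate_eigenvector; rewrite ?invr_gt0.
have [|z zP] := @bounded_sequence_cluster u (opnorm T).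
  by move=> n; rewrite (uP n).1.
exists z.
  move=> [S [bS SB _]]; pose K := opnorm S + 1.
  have K0 : 0 < K by rewrite ltr_wpDl ?opnorm_ge0.
  (* An inverse of norm below [K] would give [|y| <= K * (2 * e * |y|) = |y| / 2] for a nonzero [y];
     one [e] pays for the approximate eigenvector and one for replacing [u n] by [z]. *)
  pose e := (4 * K)^-1; have e0 : 0 < e by rewrite invr_gt0 mulr_gt0.
  have [N NP] := invS_small e0; have [n Nn uz] := zP e N e0.
  have [_ [y y0 yP]] := uP n; have ny : 0 < nrm y by rewrite nrm_gt0.
  have : nrm (z *: y - T y) <= 2 * e * nrm y.
    have -> : z *: y - T y = (u n *: y - T y) - (u n - z) *: y.
      by rewrite scalerBl opprB [RHS]addrC subrKA.
    apply: le_trans (nrmB _ _) _; rewrite nrmZ.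
    have := le_trans yP (ler_wpM2r (ltW ny) (NP n Nn)).
    by have := ler_wpM2r (ltW ny) uz; lra.
  have := opnormP (z *: y - T y) bS; rewrite SB.
  move=> h1 h2; have h3 : nrm y <= K * (2 * e * nrm y).
    apply: le_trans h1 _; apply: le_trans (ler_wpM2l (ltW K0) h2).
    by rewrite ler_wpM2r ?nrm_ge0 // lerDl.
  have Ke : K * e = 4^-1 by rewrite /e invfM mulrCA divff ?mulr1 // gt_eqF.
  by move: h3; rewrite mulrA (mulrCA K) Ke; lra.
apply/eqP; rewrite eq_le; apply/andP; split; apply: (@le_epsM _ _ _ 1) => // e e0.
  have [n _ uz] := zP e 0%N e0; rewrite -(uP n).1.
  have -> : z = u n - (u n - z) by rewrite subKr.
  by apply: le_trans (cabsD _ _) _; rewrite cabsN; lra.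
have [n _ uz] := zP e 0%N e0; rewrite -(uP n).1 -[u n](subrK z).
by apply: le_trans (cabsD _ _) _; lra.
Qed.

Theorem normaloidP T : bounded_operator T ->
  normaloid T <-> forall k, opnorm T ^+ k = opnorm (iter k T).
Proof.
move=> bT; split=> [nT [|k]|Tpow].
- by rewrite expr0 opnorm_id.
- apply/eqP; rewrite eq_le opnorm_iter_le // andbT -nT.
  exact: spectral_radius_pow_le.
apply/eqP; rewrite eq_le spectral_radius_le ?opnorm_ge0 //=; last first.
  by move=> z; exact: spectrum_le.
have [->|N0] := eqVneq (opnorm T) 0; first exact: spectral_radius_ge0.
have [|z Tz <-] := pow_norm_spectrum bT _ Tpow.
  by rewrite lt_def N0 opnorm_ge0.
exact: spectral_radius_ge.
Qed.

End SpectralRadius.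

(** * Norms of the Aluthge transform and of its powers *)

Section AluthgeNorm.
Context {R : realType} {H : hilbertType R}.
Context (H_neq0 : exists x : H, x != 0).
Context {lambda : R} (lambda01 : 0 <= lambda <= 1).
Implicit Types T : H -> H.

Lemma bounded_aluthge T : bounded_operator T -> bounded_operator (aluthge lambda T).
Proof.
move=> bT; have [B [C [bB bC _ -> _]]] := aluthge_factorization H_neq0 bT lambda01.
exact: bounded_comp.
Qed.

Lemma opnorm_aluthge_le T : bounded_operator T ->
  opnorm (aluthge lambda T) <= opnorm T.
Proof.
move=> bT; have [B [C [bB bC _ -> BC]]] := aluthge_factorization H_neq0 bT lambda01.
by apply: le_trans (opnorm_comp bC bB) _; rewrite mulrC.
Qed.

(* [(BC)^(k+1) = B (CB)^k C] bounds the powers of the transform below. *)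
Lemma aluthge_pow_norm T : bounded_operator T ->
  (forall k, opnorm T ^+ k = opnorm (iter k T)) ->
  opnorm (aluthge lambda T) = opnorm T /\
  forall k, opnorm (aluthge lambda T) ^+ k = opnorm (iter k (aluthge lambda T)).
Proof.
move=> bT Tpow; have bA := bounded_aluthge bT.
have [B [C [bB bC TE AE BC]]] := aluthge_factorization H_neq0 bT lambda01.
set A := aluthge lambda T in bA AE *; have A_le := opnorm_aluthge_le bT; rewrite -/A in A_le.
(* The main case cancels a factor [opnorm T], so the zero operator is treated apart. *)
have [N0|N0] := eqVneq (opnorm T) 0.
  have A0 : opnorm A = 0 by apply/eqP; rewrite eq_le opnorm_ge0 // andbT -N0.
  rewrite A0 N0; split=> // -[|k]; first by rewrite expr0 opnorm_id.
  apply/eqP; rewrite expr0n eq_le opnorm_ge0 /=; last exact: bounded_iter.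
  by apply: le_trans (opnorm_iter_le _ _ bA) _; rewrite ?A0 ?expr0n.
have Ngt0 : 0 < opnorm T by rewrite lt_def N0 opnorm_ge0.
have low k : opnorm T ^+ k <= opnorm (iter k A).
  have bAk := bounded_iter k bA.
  rewrite -(ler_pM2l Ngt0) -exprS Tpow.
  have -> : iter k.+1 T = B \o (iter k A \o C).
    rewrite TE AE; apply/funext => x /=; congr B.
    by elim: {bAk} k => //= j ->.
  apply: le_trans (opnorm_comp bB (bounded_comp bAk bC)) _.
  apply: le_trans (ler_wpM2l (opnorm_ge0 bB) (opnorm_comp bAk bC)) _.
  by rewrite mulrCA mulrC ler_wpM2r ?opnorm_ge0.
have AN : opnorm A = opnorm T.
  by apply/eqP; rewrite eq_le A_le; have := low 1%N; rewrite expr1.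
split=> // k; apply/eqP; rewrite eq_le opnorm_iter_le // andbT AN.
exact: low.
Qed.

End AluthgeNorm.

Theorem corollary2p4 (R : realType) (H : hilbertType R)
    (H_neq0 : exists x : H, x != 0)
    (lambda : R) (lambda01 : 0 <= lambda <= 1)
    (T : H -> H) (T_bounded : bounded_operator T) :
  (normaloid T <->
     forall k : nat, opnorm T ^+ k = opnorm (aluthge lambda (iter k T))) /\
  (normaloid T <->
     forall k n : nat,
       opnorm T ^+ k = opnorm (iter n (aluthge lambda) (iter k T))).
Proof.
have i_iii : normaloid T -> forall k n : nat,
    opnorm T ^+ k = opnorm (iter n (aluthge lambda) (iter k T)).
  move=> /(normaloidP H_neq0 T_bounded) Tpow k n.
  (* The induction on [n] must also carry the power identity for the current iterate, since
     [aluthge_pow_norm] consumes and returns it. *)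
  suff [_ []] : bounded_operator (iter n (aluthge lambda) (iter k T)) /\
      opnorm (iter n (aluthge lambda) (iter k T)) = opnorm T ^+ k /\
      forall j, opnorm (iter n (aluthge lambda) (iter k T)) ^+ j =
        opnorm (iter j (iter n (aluthge lambda) (iter k T))) by [].
  elim: n => [|n [bS [SN Spow]]] /=.
    split; first exact: bounded_iter.
    (* The power identity passes from [T] to [T^k] because the [j]-th power of [T^k] is again a
       power of [T]. *)
    split=> // j; rewrite -Tpow -exprM mulnC Tpow; congr opnorm.
    by apply/funext => x; rewrite iterM.
  have [AN Apow] := aluthge_pow_norm H_neq0 lambda01 bS Spow.
  split; first exact: bounded_aluthge.
  by split=> //; rewrite AN.
have ii_i : (forall k : nat, opnorm T ^+ k = opnorm (aluthge lambda (iter k T))) ->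
    normaloid T.
  move=> ii; apply/(normaloidP H_neq0 T_bounded) => k.
  apply/eqP; rewrite eq_le opnorm_iter_le // andbT ii.
  by apply: opnorm_aluthge_le => //; exact: bounded_iter.
split; split=> //; first by move=> nT k; exact: i_iii nT k 1%N.
by move=> iii; apply: ii_i => k; exact: iii k 1%N.
Qed.
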